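(* Let $\gamma=\frac{\pi i}{3}E_2$ and let $F(t_1,t_2,t_3)=\frac12t_1^2t_3+\frac12t_1t_2^2-\frac{t_2^4}{16}\gamma(t_3)$ on $\mathbb C^2\times\mathfrak H$. Then the metric is $\eta=dt_2^2+2\,dt_1dt_3$, and for every $(t_1,t_2,t_3)\in\mathbb C\times\mathbb C^\times\times\mathfrak H$ the three roots in $u$ of $\det\big(g^{ij}(t)-u\,\eta^{ij}\big)=0$ are $$u_i=t_1+\tfrac12t_2^2\mathscr N_i(t_3),\qquad i=1,2,3,$$ where $\mathscr N_1,\mathscr N_2,\mathscr N_3$ are holomorphic functions on $\mathfrak H$ which are, for each $\tau$, the three (distinct) roots of $\mathscr N^3+\frac32\gamma(\tau)\mathscr N^2+\frac32\gamma'(\tau)\mathscr N+\frac14\gamma''(\tau)=0$. These $u_i$ are pairwise distinct on $\mathbb C\times\mathbb C^\times\times\mathfrak H$ and are canonical coordinates of the Frobenius structure there, i.e. $\partial_{u_i}\circ\partial_{u_j}=\delta_{ij}\partial_{u_i}$.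
   Context: $E_2(\tau)=1-24\sum_{n\ge1}\sigma_1(n)q^n$, $q=e^{2\pi i\tau}$; $\gamma$ satisfies $\gamma'''=6\gamma\gamma''-9\gamma'^2$. Frobenius structure defined by $F$: with $C_{ijk}=\partial_{t_i}\partial_{t_j}\partial_{t_k}F$, the metric is $\eta_{ij}=C_{1ij}$ (constant), $\eta^{ij}=(\eta_{ij})^{-1}$, structure constants $C_{ij}^k=\eta^{kl}C_{lij}$ (summation convention), and multiplication $\partial_{t_i}\circ\partial_{t_j}=C_{ij}^k\partial_{t_k}$, which is commutative and associative with unit $\partial_{t_1}$. Euler vector field $E=t_1\partial_{t_1}+\frac12t_2\partial_{t_2}$ (components $E^l$). Intersection form: $C_k^{ij}=\eta^{il}C_{lk}^j$ and $g^{ij}(t)=E^l(t)C_l^{ij}(t)$. *)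

(* Defs.v *)
From Stdlib Require Import Reals ClassicalEpsilon List Arith.
From Coquelicot Require Import Coquelicot.
Open Scope C_scope.

Definition cexp (z : C) : C :=
  (exp (Re z) * cos (Im z), exp (Re z) * sin (Im z))%R.

Definition in_H (tau : C) : Prop := (0 < Im tau)%R.

Definition sigma1 (n : nat) : nat :=
  fold_right Nat.add 0%nat
    (filter (fun d => Nat.eqb (Nat.modulo n d) 0) (seq 1 n)).

Definition csum (a : nat -> C) : C :=
  epsilon (inhabits (RtoC 0))
    (fun l => is_series (K:=C_AbsRing) (V:=C_NormedModule) a l).

Definition qnome (tau : C) : C := cexp (RtoC (2 * PI) * Ci * tau).

Definition E2 (tau : C) : C :=
  1 - RtoC 24 * csum (fun n => RtoC (INR (sigma1 (S n))) * Cpow (qnome tau) (S n)).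

Definition gamma (tau : C) : C := RtoC PI * Ci / RtoC 3 * E2 tau.

(** complex derivative (chosen classically; the true derivative whenever
    f is complex differentiable at z) *)
Definition cderiv (f : C -> C) (z : C) : C :=
  epsilon (inhabits (RtoC 0))
    (fun l => is_derive (K:=C_AbsRing) (V:=C_NormedModule) f z l).

Definition holo_at (f : C -> C) (z : C) : Prop :=
  ex_derive (K:=C_AbsRing) (V:=C_NormedModule) f z.

(** Points of C^3 are functions nat -> C; index k = 0,1,2 stands for the
    coordinate t_{k+1}. *)
Definition pt := nat -> C.

Definition upd (t : pt) (i : nat) (s : C) : pt :=
  fun k => if Nat.eqb k i then s else t k.

Definition pd (i : nat) (f : pt -> C) (t : pt) : C :=
  cderiv (fun s => f (upd t i s)) (t i).

Definition sum3 (f : nat -> C) : C := f 0%nat + f 1%nat + f 2%nat.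

Definition det3 (M : nat -> nat -> C) : C :=
    M 0%nat 0%nat * M 1%nat 1%nat * M 2%nat 2%nat
  + M 0%nat 1%nat * M 1%nat 2%nat * M 2%nat 0%nat
  + M 0%nat 2%nat * M 1%nat 0%nat * M 2%nat 1%nat
  - M 0%nat 2%nat * M 1%nat 1%nat * M 2%nat 0%nat
  - M 0%nat 1%nat * M 1%nat 0%nat * M 2%nat 2%nat
  - M 0%nat 0%nat * M 1%nat 2%nat * M 2%nat 1%nat.

Definition nxt (i : nat) : nat := Nat.modulo (S i) 3.
Definition nxt2 (i : nat) : nat := Nat.modulo (S (S i)) 3.

Definition cof3 (M : nat -> nat -> C) (i j : nat) : C :=
  M (nxt i) (nxt j) * M (nxt2 i) (nxt2 j) - M (nxt i) (nxt2 j) * M (nxt2 i) (nxt j).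

Definition inv3 (M : nat -> nat -> C) (i j : nat) : C :=
  cof3 M j i / det3 M.

Definition Fpot (t : pt) : C :=
  / RtoC 2 * t 0%nat * t 0%nat * t 2%nat + / RtoC 2 * t 0%nat * t 1%nat * t 1%nat
  - Cpow (t 1%nat) 4 / RtoC 16 * gamma (t 2%nat).

Definition C3 (i j k : nat) (t : pt) : C := pd i (pd j (pd k Fpot)) t.

Definition eta (t : pt) (i j : nat) : C := C3 0%nat i j t.

Definition etainv (t : pt) (i j : nat) : C := inv3 (eta t) i j.

Definition Cstr (t : pt) (i j k : nat) : C :=
  sum3 (fun l => etainv t k l * C3 l i j t).

Definition prod_vec (t : pt) (a b : nat -> C) (m : nat) : C :=
  sum3 (fun k => sum3 (fun l => a k * b l * Cstr t k l m)).

Definition Euler (t : pt) (l : nat) : C :=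
  match l with
  | 0%nat => t 0%nat
  | 1%nat => / RtoC 2 * t 1%nat
  | _ => 0
  end.

Definition Cup (t : pt) (k i j : nat) : C :=
  sum3 (fun l => etainv t i l * Cstr t l k j).

Definition gint (t : pt) (i j : nat) : C :=
  sum3 (fun l => Euler t l * Cup t l i j).

(** canonical coordinates: u = (u_1,u_2,u_3) (indices 0,1,2) are canonical
    coordinates at t if the Jacobian J_{ik} = du_i/dt_k is invertible and
    the coordinate vector fields d/du_i, with components
    (d t_k / d u_i) = (J^{-1})_{k i}, satisfy d_{u_i} o d_{u_j} = delta_ij d_{u_i}. *)
Definition jac (u : nat -> pt -> C) (t : pt) (i k : nat) : C := pd k (u i) t.

Definition canonical_coords_at (u : nat -> pt -> C) (t : pt) : Prop :=
  det3 (jac u t) <> 0 /\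
  forall i j m : nat, (i < 3)%nat -> (j < 3)%nat -> (m < 3)%nat ->
    prod_vec t (fun k => inv3 (jac u t) k i) (fun k => inv3 (jac u t) k j) m
    = (if Nat.eqb i j then inv3 (jac u t) m i else 0).

(* Main.v *)
(** With [x = exp (pi i tau)], the roots [N_i] are [4 pi i V(x)], [4 pi i V(-x)] and
    [- pi i / 2 - 4 pi i W(x)] for explicit divisor-sum series [V], [W]. They solve the Halphen
    system [(N_i + N_j)' = - 2 N_i N_j], which amounts to convolution identities for divisor sums
    over [a x + b y = n], proved by Liouville's elementary shear argument. As
    [gamma = - 2/3 (N_1 + N_2 + N_3)], the Halphen system gives [gamma' = 2/3 e_2] and
    [gamma'' = - 4 e_3], so the cubic is [(N - N_1) (N - N_2) (N - N_3)]. Since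
    [(N_i - N_j)' = - 2 N_k (N_i - N_j)] is a linear equation and the leading coefficient of
    [N_i - N_j] at [x = 0] does not vanish, the roots stay distinct. The determinant and the
    idempotent products are then polynomial identities in [t_1], [t_2] and the [N_i]. *)

Require Import Defs.
From Stdlib Require Import Reals ZArith List Permutation Lia Lra Psatz ClassicalEpsilon.
From Coquelicot Require Import Coquelicot.
Open Scope bool_scope.
Open Scope Z_scope.

(** The Halphen form is chosen because its equations are bilinear in first-power divisor sums: each
    is one convolution identity with a linear right side, whereas differentiating [E2] directly
    brings in [E4], [E6] and sums of higher powers of divisors. As [V(-x)] is itself one of the
    three series and [W] is even, two identities suffice, for [V(x) V(-x)] and for [V(x) W(x)]; the
    third equation is the second under [x |-> -x]. The constant term [- pi i / 2] of the third root
    produces the undifferentiated [V] in the second identity. Global series for the roots give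
    holomorphy and a consistent labelling on all of the half-plane, which an implicit function
    argument would give only locally. Distinctness is harder to see on the series: written with
    [x d/dx], the linear equation for a difference is singular at [x = 0], so the leading power of
    [x] is divided out before a Gronwall estimate is run along a segment from [0]. Derivatives and
    infinite sums in the statement are chosen by [epsilon], and [gamma] is controlled only on the
    upper half-plane; hence every formula is transported along that open set. *)

Definition zsum {A : Type} (f : A -> Z) (l : list A) : Z :=
  fold_right (fun x s => f x + s) 0 l.

Lemma zsum_ext {A : Type} (f g : A -> Z) (l : list A) :
  (forall x, In x l -> f x = g x) -> zsum f l = zsum g l.
Proof.
  induction l as [|x l IH]; simpl; intros H; [reflexivity|].
  rewrite (H x), IH; auto.
Qed.

Lemma zsum_app {A : Type} (f : A -> Z) (l m : list A) :
  zsum f (l ++ m) = zsum f l + zsum f m.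
Proof. induction l as [|x l IH]; simpl; [|rewrite IH]; lia. Qed.

Lemma zsum_map {A B : Type} (f : B -> Z) (h : A -> B) (l : list A) :
  zsum f (map h l) = zsum (fun x => f (h x)) l.
Proof. induction l as [|x l IH]; simpl; [|rewrite IH]; lia. Qed.

Lemma zsum_plus {A : Type} (f g : A -> Z) (l : list A) :
  zsum (fun x => f x + g x) l = zsum f l + zsum g l.
Proof. induction l as [|x l IH]; simpl; [|rewrite IH]; lia. Qed.

Lemma zsum_scal {A : Type} (c : Z) (f : A -> Z) (l : list A) :
  zsum (fun x => c * f x) l = c * zsum f l.
Proof. induction l as [|x l IH]; simpl; [|rewrite IH]; lia. Qed.

Lemma zsum_filter {A : Type} (c : A -> bool) (f : A -> Z) (l : list A) :
  zsum f (filter c l) = zsum (fun x => if c x then f x else 0) l.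
Proof. induction l as [|x l IH]; simpl; [|destruct (c x); simpl; rewrite IH]; lia. Qed.

Lemma zsum_flat_map {A B : Type} (f : B -> Z) (h : A -> list B) (l : list A) :
  zsum f (flat_map h l) = zsum (fun x => zsum f (h x)) l.
Proof. induction l as [|x l IH]; simpl; [|rewrite zsum_app, IH]; lia. Qed.

Lemma zsum_list_prod {A B : Type} (f : A -> Z) (g : B -> Z) (l : list A) (m : list B) :
  zsum (fun p => f (fst p) * g (snd p)) (list_prod l m) = zsum f l * zsum g m.
Proof.
  induction l as [|x l IH]; simpl; [lia|].
  rewrite zsum_app, IH, zsum_map; simpl; rewrite zsum_scal; lia.
Qed.

Lemma zsum_perm {A : Type} (f : A -> Z) (l m : list A) :
  Permutation l m -> zsum f l = zsum f m.
Proof. induction 1; simpl; lia. Qed.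

(** Mutually inverse maps between duplicate-free lists give a permutation. Every change of variables
    below is an instance, so that only membership and arithmetic remain to be checked. *)
Lemma zsum_reindex {A B : Type} (h : A -> B) (k : B -> A) (f : A -> Z) (g : B -> Z)
  (l : list A) (m : list B) :
  NoDup l -> NoDup m ->
  (forall x, In x l -> In (h x) m /\ k (h x) = x /\ f x = g (h x)) ->
  (forall y, In y m -> In (k y) l /\ h (k y) = y) ->
  zsum f l = zsum g m.
Proof.
  intros Nl Nm Hl Hm.
  rewrite (zsum_ext f (fun x => g (h x))) by (intros x Hx; apply Hl; auto).
  rewrite <- zsum_map. apply zsum_perm, NoDup_Permutation; auto.
  - clear Nm Hm. induction Nl as [|x l Hx Nl IH]; simpl; constructor.
    + intros Hin. apply in_map_iff in Hin. destruct Hin as [y [E Hy]].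
      apply Hx. destruct (Hl x) as [_ [E1 _]]; [now left|].
      destruct (Hl y) as [_ [E2 _]]; [now right|].
      rewrite <- E1, <- E, E2. exact Hy.
    + apply IH. intros y Hy. apply Hl. now right.
  - intros y. rewrite in_map_iff. split.
    + intros [x [E Hx]]. subst. now apply Hl.
    + intros Hy. exists (k y). split; apply Hm; auto.
Qed.

Lemma NoDup_map_inj {A B : Type} (h : A -> B) (l : list A) :
  (forall x y, h x = h y -> x = y) -> NoDup l -> NoDup (map h l).
Proof.
  intros Hh N. induction N as [|x l Hx N IH]; simpl; constructor; auto.
  rewrite in_map_iff. intros [y [E Hy]]. apply Hh in E. now subst.
Qed.

Lemma NoDup_app_disjoint {A : Type} (l m : list A) :
  NoDup l -> NoDup m -> (forall x, In x l -> ~ In x m) -> NoDup (l ++ m).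
Proof.
  intros Nl Nm. induction Nl as [|x l Hx Nl IH]; simpl; intros D; auto.
  constructor.
  - rewrite in_app_iff. intros [H|H]; [auto|]. now apply (D x); [left|].
  - apply IH. intros y Hy. apply D. now right.
Qed.

(** [tag] recovers from an element the block it came from, so distinct blocks are disjoint. *)
Lemma NoDup_flat_map_tagged {A B : Type} (h : A -> list B) (tag : B -> A) (l : list A) :
  NoDup l -> (forall x, In x l -> NoDup (h x)) ->
  (forall x y, In y (h x) -> tag y = x) -> NoDup (flat_map h l).
Proof.
  intros N Hn Ht. induction N as [|x l Hx N IH]; simpl; [constructor|].
  apply NoDup_app_disjoint.
  - apply Hn. now left.
  - apply IH. intros y Hy. apply Hn. now right.
  - intros y Hy Hy'. apply in_flat_map in Hy'. destruct Hy' as [x' [Hx' Hy']].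
    apply Ht in Hy. apply Ht in Hy'. subst. auto.
Qed.

Lemma NoDup_list_prod {A B : Type} (l : list A) (m : list B) :
  NoDup l -> NoDup m -> NoDup (list_prod l m).
Proof.
  intros Nl Nm. induction Nl as [|x l Hx Nl IH]; simpl; [constructor|].
  apply NoDup_app_disjoint; auto.
  - apply NoDup_map_inj; auto. congruence.
  - intros [u v] H1 H2. apply in_map_iff in H1. destruct H1 as [y [E _]].
    apply in_prod_iff in H2. inversion E. subst. tauto.
Qed.

(** * Solution sets of [a x = n] and [a x + b y = n] in positive integers *)

Definition zrange (n : Z) : list Z := map Z.of_nat (seq 1 (Z.to_nat n)).

Lemma in_zrange (n z : Z) : In z (zrange n) <-> 1 <= z <= n.
Proof.
  unfold zrange. rewrite in_map_iff. split.
  - intros [k [E H]]. apply in_seq in H. lia.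
  - intros H. exists (Z.to_nat z). rewrite in_seq. lia.
Qed.

Lemma NoDup_zrange (n : Z) : NoDup (zrange n).
Proof. apply NoDup_map_inj; [lia|apply seq_NoDup]. Qed.

Definition factors (n : nat) : list (Z * Z) :=
  filter (fun p => fst p * snd p =? Z.of_nat n)
    (list_prod (zrange (Z.of_nat n)) (zrange (Z.of_nat n))).

Lemma in_factors (n : nat) (a x : Z) :
  In (a, x) (factors n) <-> 1 <= a /\ 1 <= x /\ a * x = Z.of_nat n.
Proof.
  unfold factors. rewrite filter_In, in_prod_iff, !in_zrange. simpl.
  rewrite Z.eqb_eq. split; [tauto|]. intros (H1 & H2 & H3). nia.
Qed.

Lemma NoDup_factors (n : nat) : NoDup (factors n).
Proof. apply NoDup_filter, NoDup_list_prod; apply NoDup_zrange. Qed.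

(** Assembled by the value [k = a x], so that sums of products over it are convolutions by
    construction. The blocks [k = 0] and [k = n] are empty because [factors 0] is. *)
Definition quads (n : nat) : list ((Z * Z) * (Z * Z)) :=
  flat_map (fun k => list_prod (factors k) (factors (n - k))) (seq 0 (S n)).

Lemma in_quads (n : nat) (a b x y : Z) :
  In ((a, x), (b, y)) (quads n) <->
  1 <= a /\ 1 <= x /\ 1 <= b /\ 1 <= y /\ a * x + b * y = Z.of_nat n.
Proof.
  unfold quads. rewrite in_flat_map. split.
  - intros [k [Hk H]]. apply in_seq in Hk.
    apply in_prod_iff in H. rewrite !in_factors in H. lia.
  - intros (Ha & Hx & Hb & Hy & E). exists (Z.to_nat (a * x)).
    assert (0 <= a * x) by nia. assert (0 <= b * y) by nia.
    rewrite in_seq, in_prod_iff, !in_factors. lia.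
Qed.

Lemma NoDup_quads (n : nat) : NoDup (quads n).
Proof.
  apply (NoDup_flat_map_tagged _ (fun p => Z.to_nat (fst (fst p) * snd (fst p)))).
  - apply seq_NoDup.
  - intros k _. apply NoDup_list_prod; apply NoDup_factors.
  - intros k [[a x] [b y]] H. apply in_prod_iff in H. rewrite !in_factors in H. simpl. lia.
Qed.

Definition fsum (n : nat) (g : Z -> Z -> Z) : Z :=
  zsum (fun p => g (fst p) (snd p)) (factors n).

Definition qsum (n : nat) (f : Z -> Z -> Z -> Z -> Z) : Z :=
  zsum (fun p => f (fst (fst p)) (fst (snd p)) (snd (fst p)) (snd (snd p))) (quads n).

Lemma fsum_ext (n : nat) (f g : Z -> Z -> Z) :
  (forall a x, 1 <= a -> 1 <= x -> a * x = Z.of_nat n -> f a x = g a x) ->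
  fsum n f = fsum n g.
Proof. intros H. apply zsum_ext. intros [a x] Hp. apply in_factors in Hp. apply H; tauto. Qed.

Lemma qsum_ext (n : nat) (f g : Z -> Z -> Z -> Z -> Z) :
  (forall a b x y, 1 <= a -> 1 <= b -> 1 <= x -> 1 <= y -> a * x + b * y = Z.of_nat n ->
    f a b x y = g a b x y) ->
  qsum n f = qsum n g.
Proof. intros H. apply zsum_ext. intros [[a x] [b y]] Hp. apply in_quads in Hp. apply H; tauto. Qed.

Lemma fsum_plus (n : nat) (f g : Z -> Z -> Z) :
  fsum n (fun a x => f a x + g a x) = fsum n f + fsum n g.
Proof. apply zsum_plus. Qed.

Lemma fsum_scal (n : nat) (c : Z) (f : Z -> Z -> Z) :
  fsum n (fun a x => c * f a x) = c * fsum n f.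
Proof. apply zsum_scal. Qed.

Lemma qsum_plus (n : nat) (f g : Z -> Z -> Z -> Z -> Z) :
  qsum n (fun a b x y => f a b x y + g a b x y) = qsum n f + qsum n g.
Proof. apply zsum_plus. Qed.

Lemma qsum_scal (n : nat) (c : Z) (f : Z -> Z -> Z -> Z -> Z) :
  qsum n (fun a b x y => c * f a b x y) = c * qsum n f.
Proof. apply zsum_scal. Qed.

Lemma qsum_convolution (n : nat) (f g : Z -> Z -> Z) :
  qsum n (fun a b x y => f a x * g b y) =
  zsum (fun k => fsum k f * fsum (n - k) g) (seq 0 (S n)).
Proof.
  unfold qsum, quads. rewrite zsum_flat_map. apply zsum_ext. intros k _.
  exact (zsum_list_prod (fun p => f (fst p) (snd p)) (fun p => g (fst p) (snd p)) _ _).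
Qed.

(** * Symmetries of the solution set and its diagonals *)

Lemma qsum_swap (n : nat) (f : Z -> Z -> Z -> Z -> Z) :
  qsum n f = qsum n (fun a b x y => f b a y x).
Proof.
  apply (zsum_reindex (fun p => (snd p, fst p)) (fun p => (snd p, fst p)));
    try apply NoDup_quads; intros [[a x] [b y]] H; cbn [fst snd]; rewrite !in_quads in *;
    repeat split; lia.
Qed.

(* The shear [(a, b, x, y) |-> (a, b - a, x + y, y)] preserves [a x + b y]. *)
Lemma qsum_shear (n : nat) (f : Z -> Z -> Z -> Z -> Z) :
  qsum n (fun a b x y => if a <? b then f a b x y else 0) =
  qsum n (fun a b x y => if y <? x then f a (a + b) (x - y) y else 0).
Proof.
  unfold qsum.
  rewrite <- (zsum_filter (fun p => fst (fst p) <? fst (snd p))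
     (fun p => f (fst (fst p)) (fst (snd p)) (snd (fst p)) (snd (snd p)))).
  rewrite <- (zsum_filter (fun p => snd (snd p) <? snd (fst p))
     (fun p => f (fst (fst p)) (fst (fst p) + fst (snd p)) (snd (fst p) - snd (snd p)) (snd (snd p)))).
  apply (zsum_reindex
    (fun p => ((fst (fst p), snd (fst p) + snd (snd p)), (fst (snd p) - fst (fst p), snd (snd p))))
    (fun p => ((fst (fst p), snd (fst p) - snd (snd p)), (fst (fst p) + fst (snd p), snd (snd p)))));
    try apply NoDup_filter, NoDup_quads;
    intros [[a x] [b y]] H; rewrite filter_In, in_quads in H; cbn [fst snd] in *;
    rewrite ?filter_In, ?in_quads; cbn [fst snd]; rewrite ?Z.ltb_lt in *.
  - repeat split; try nia; [repeat f_equal; lia|].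
    f_equal; lia.
  - repeat split; try nia. repeat f_equal; lia.
Qed.

(** The shear conjugated by the swap of [(a, x)] with [(b, y)]. *)
Lemma qsum_shear_right (n : nat) (f : Z -> Z -> Z -> Z -> Z) :
  qsum n (fun a b x y => if b <? a then f a b x y else 0) =
  qsum n (fun a b x y => if x <? y then f (a + b) b x (y - x) else 0).
Proof.
  rewrite qsum_swap, (qsum_shear n (fun a b x y => f b a y x)), qsum_swap.
  apply qsum_ext. intros. destruct (x <? y); [f_equal; lia|reflexivity].
Qed.

Lemma qsum_trichotomy_ab (n : nat) (f : Z -> Z -> Z -> Z -> Z) :
  qsum n f = qsum n (fun a b x y => if a <? b then f a b x y else 0)
    + qsum n (fun a b x y => if b <? a then f a b x y else 0)
    + qsum n (fun a b x y => if a =? b then f a b x y else 0).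
Proof.
  rewrite <- !qsum_plus. apply qsum_ext. intros.
  destruct (Z.ltb_spec a b), (Z.ltb_spec b a), (Z.eqb_spec a b); lia.
Qed.

Lemma qsum_trichotomy_xy (n : nat) (f : Z -> Z -> Z -> Z -> Z) :
  qsum n f = qsum n (fun a b x y => if y <? x then f a b x y else 0)
    + qsum n (fun a b x y => if x <? y then f a b x y else 0)
    + qsum n (fun a b x y => if x =? y then f a b x y else 0).
Proof.
  rewrite <- !qsum_plus. apply qsum_ext. intros.
  destruct (Z.ltb_spec y x), (Z.ltb_spec x y), (Z.eqb_spec x y); lia.
Qed.

(** For [a = b = d] the equation reads [d (x + y) = n]: a factorisation [d z = n] together with a
    splitting of [z] into two positive parts, of which there are [z - 1]. *)
Lemma qsum_diag_ab (n : nat) (f : Z -> Z -> Z -> Z -> Z) :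
  qsum n (fun a b x y => if a =? b then f a b x y else 0) =
  fsum n (fun d z => zsum (fun x => f d d x (z - x)) (zrange (z - 1))).
Proof.
  unfold qsum, fsum.
  rewrite <- (zsum_filter (fun p => fst (fst p) =? fst (snd p))
     (fun p => f (fst (fst p)) (fst (snd p)) (snd (fst p)) (snd (snd p)))).
  transitivity (zsum (fun p => f (fst (fst p)) (fst (fst p)) (snd p) (snd (fst p) - snd p))
    (flat_map (fun q => map (pair q) (zrange (snd q - 1))) (factors n))).
  - apply (zsum_reindex
      (fun p => ((fst (fst p), snd (fst p) + snd (snd p)), snd (fst p)))
      (fun r => ((fst (fst r), snd r), (fst (fst r), snd (fst r) - snd r)))).
    + apply NoDup_filter, NoDup_quads.
    + apply (NoDup_flat_map_tagged _ fst).
      * apply NoDup_factors.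
      * intros q _. apply NoDup_map_inj; [congruence|apply NoDup_zrange].
      * intros q r H. apply in_map_iff in H. destruct H as [s [E _]]. now subst.
    + intros [[a x] [b y]] H; rewrite filter_In, in_quads in H; cbn [fst snd] in *.
      rewrite Z.eqb_eq in H. destruct H as [H E]. subst b. repeat split.
      * apply in_flat_map. exists (a, x + y). rewrite in_factors. split; [nia|].
        apply in_map. apply in_zrange. cbn. lia.
      * repeat f_equal; lia.
      * f_equal; lia.
    + intros [[d z] x] H. apply in_flat_map in H. destruct H as [[d' z'] [H1 H2]].
      apply in_map_iff in H2. destruct H2 as [x' [E H2]].
      inversion E; subst. apply in_zrange in H2. apply in_factors in H1. cbn [fst snd] in *.
      split; [|repeat f_equal; lia].
      rewrite filter_In, in_quads. cbn [fst snd]. rewrite Z.eqb_eq. nia.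
  - rewrite zsum_flat_map. apply zsum_ext. intros [d z] _. rewrite zsum_map. reflexivity.
Qed.

(** Coefficients and unknowns play symmetric roles; this turns the diagonal [a = b] into the
    diagonal [x = y]. *)
Lemma qsum_flip (n : nat) (f : Z -> Z -> Z -> Z -> Z) :
  qsum n f = qsum n (fun a b x y => f x y a b).
Proof.
  apply (zsum_reindex (fun p => ((snd (fst p), fst (fst p)), (snd (snd p), fst (snd p))))
    (fun p => ((snd (fst p), fst (fst p)), (snd (snd p), fst (snd p)))));
    try apply NoDup_quads; intros [[a x] [b y]] H; cbn [fst snd]; rewrite !in_quads in *;
    repeat split; lia.
Qed.

Lemma fsum_flip (n : nat) (f : Z -> Z -> Z) : fsum n f = fsum n (fun a x => f x a).
Proof.
  apply (zsum_reindex (fun p => (snd p, fst p)) (fun p => (snd p, fst p)));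
    try apply NoDup_factors; intros [a x] H; cbn [fst snd]; rewrite !in_factors in *;
    repeat split; lia.
Qed.

Lemma qsum_diag_xy (n : nat) (f : Z -> Z -> Z -> Z -> Z) :
  qsum n (fun a b x y => if x =? y then f a b x y else 0) =
  fsum n (fun d z => zsum (fun a => f a (d - a) z z) (zrange (d - 1))).
Proof. rewrite qsum_flip, (qsum_diag_ab n (fun a b x y => f x y a b)). apply fsum_flip. Qed.

(** Summation by telescoping: [P] is a guessed closed form, verified through its increments. *)
Lemma zsum_zrange (f P : Z -> Z) :
  P 0 = 0 -> (forall m, 0 <= m -> P (m + 1) = P m + f (m + 1)) ->
  forall m, 0 <= m -> zsum f (zrange m) = P m.
Proof.
  intros H0 HS m Hm. rewrite <- (Z2Nat.id m Hm). unfold zrange. rewrite Nat2Z.id.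
  induction (Z.to_nat m) as [|k IH]; [symmetry; exact H0|].
  rewrite seq_S, map_app, zsum_app, IH. cbn [zsum map fold_right].
  replace (Z.of_nat (S k)) with (Z.of_nat k + 1) by lia.
  replace (Z.of_nat (1 + k)) with (Z.of_nat k + 1) by lia.
  rewrite HS by lia. lia.
Qed.

(** * Divisor sums with parity conditions, and the sums met on the diagonals *)

Definition sgn (z : Z) : Z := if Z.even z then 1 else -1.

Lemma sgn_add (a b : Z) : sgn (a + b) = sgn a * sgn b.
Proof. unfold sgn. rewrite Z.even_add. destruct (Z.even a), (Z.even b); reflexivity. Qed.

(* Up to constants, [sum v x^n], [sum v (-x)^n] and [sum w x^n] with [x = exp (pi i tau)] are
   the logarithmic derivatives of the theta constants. *)
Definition vcoef (n : nat) : Z := fsum n (fun c e => if Z.odd e then c else 0).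

Definition wcoef (n : nat) : Z := fsum n (fun c e => if Z.even e then - (sgn c * c) else 0).

(** The even cofactor makes this series one in [x^2 = q], namely the one of [sigma1]. *)
Definition scoef (n : nat) : Z := fsum n (fun c e => if Z.even e then c else 0).

Ltac parity_cases a b x y :=
  rewrite <- ?Z.negb_even, ?Z.even_add, ?Z.even_sub in *;
  destruct (Z.even a) eqn:?, (Z.even b) eqn:?, (Z.even x) eqn:?, (Z.even y) eqn:?;
  cbn [andb negb orb Bool.eqb] in *; try discriminate; try ring.

Ltac parity_of E :=
  let E' := fresh in
  pose proof (f_equal Z.even E) as E'; rewrite ?Z.even_add, ?Z.even_mul in E'.

Lemma even_succ_flip (z : Z) : Z.even (z + 1) = negb (Z.even z).
Proof. rewrite Z.even_add. destruct (Z.even z); reflexivity. Qed.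

Lemma even_odd_count (z : Z) : 1 <= z ->
  2 * zsum (fun x => if Z.even x && Z.odd (z - x) then 1 else 0) (zrange (z - 1)) =
  if Z.odd z then z - 1 else 0.
Proof.
  intros Hz. rewrite <- zsum_scal. destruct (Z.odd z) eqn:Ez.
  (* For odd [z] the condition on [z - x] follows from [x] being even, so the partial sum is twice
     the number of even integers up to [m]. *)
  - rewrite (zsum_zrange _ (fun m => if Z.even m then m else m - 1)); try reflexivity; try lia.
    + replace (Z.even (z - 1)) with true; [lia|].
      rewrite Z.even_sub. rewrite <- Z.negb_even in Ez. destruct (Z.even z); easy.
    + intros m Hm. rewrite <- Z.negb_even in *. rewrite Z.even_sub, even_succ_flip.
      destruct (Z.even m), (Z.even z); cbn in *; try discriminate; lia.
  - rewrite (zsum_zrange _ (fun m => 0)); try reflexivity; try lia.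
    intros m Hm. rewrite <- Z.negb_even in *. rewrite Z.even_sub, even_succ_flip.
    destruct (Z.even m), (Z.even z); cbn in *; try discriminate; lia.
Qed.

Lemma odd_odd_count (z : Z) : 1 <= z ->
  2 * zsum (fun x => if Z.odd x && Z.odd (z - x) then 1 else 0) (zrange (z - 1)) =
  if Z.even z then z else 0.
Proof.
  intros Hz. rewrite <- zsum_scal. destruct (Z.even z) eqn:Ez.
  - rewrite (zsum_zrange _ (fun m => if Z.even m then m else m + 1)); try reflexivity; try lia.
    + replace (Z.even (z - 1)) with false; [lia|].
      rewrite Z.even_sub. destruct (Z.even z); easy.
    + intros m Hm. rewrite <- !Z.negb_even in *. rewrite Z.even_sub, even_succ_flip.
      destruct (Z.even m), (Z.even z); cbn in *; try discriminate; lia.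
  - rewrite (zsum_zrange _ (fun m => 0)); try reflexivity; try lia.
    intros m Hm. rewrite <- !Z.negb_even in *. rewrite Z.even_sub, even_succ_flip.
    destruct (Z.even m), (Z.even z); cbn in *; try discriminate; lia.
Qed.

Lemma odd_even_count (z : Z) : 1 <= z ->
  2 * zsum (fun x => if Z.odd x && Z.even (z - x) then 1 else 0) (zrange (z - 1)) =
  if Z.odd z then z - 1 else 0.
Proof.
  intros Hz. rewrite <- zsum_scal. destruct (Z.odd z) eqn:Ez.
  - rewrite (zsum_zrange _ (fun m => if Z.even m then m else m + 1)); try reflexivity; try lia.
    + replace (Z.even (z - 1)) with true; [lia|].
      rewrite Z.even_sub. rewrite <- Z.negb_even in Ez. destruct (Z.even z); easy.
    + intros m Hm. rewrite <- Z.negb_even in *. rewrite Z.even_sub, even_succ_flip.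
      destruct (Z.even m), (Z.even z); cbn in *; try discriminate; lia.
  - rewrite (zsum_zrange _ (fun m => 0)); try reflexivity; try lia.
    intros m Hm. rewrite <- Z.negb_even in *. rewrite Z.even_sub, even_succ_flip.
    destruct (Z.even m), (Z.even z); cbn in *; try discriminate; lia.
Qed.

Lemma sgn_sum (d : Z) : 1 <= d -> Z.even d = true ->
  zsum (fun a => sgn (d - a)) (zrange (d - 1)) = -1.
Proof.
  intros Hd Ed.
  rewrite (zsum_zrange _ (fun m => if Z.even m then 0 else -1)); try reflexivity; try lia.
  - rewrite Z.even_sub, Ed. reflexivity.
  - intros m Hm. unfold sgn. rewrite Z.even_sub, even_succ_flip, Ed.
    destruct (Z.even m); reflexivity.
Qed.

(** Alternating sums of squares are triangular numbers: [m^2 - (m-1)^2 + ... = m (m+1) / 2], taken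
    at [m = d - 1], where the leading sign is [sgn 1]. *)
Lemma sgn_square_sum (d : Z) : 1 <= d ->
  2 * zsum (fun a => sgn (d - a) * (a * a)) (zrange (d - 1)) = - (d * (d - 1)).
Proof.
  intros Hd. rewrite <- zsum_scal.
  rewrite (zsum_zrange _ (fun m => sgn (d - m) * (m * (m + 1)))); try reflexivity; try lia.
  - replace (d - (d - 1)) with 1 by lia. unfold sgn. cbn [Z.even]. ring.
  - intros m Hm. unfold sgn. rewrite !Z.even_sub, even_succ_flip.
    destruct (Z.even m), (Z.even d); cbn [negb Bool.eqb]; ring.
Qed.

(** * The two convolution identities *)

Lemma qsum_split (n : nat) (f g h : Z -> Z -> Z -> Z -> Z) :
  (forall a b x y, 1 <= a -> 1 <= b -> 1 <= x -> 1 <= y -> a * x + b * y = Z.of_nat n ->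
    f a b x y = g a b x y + h a b x y) ->
  qsum n f = qsum n g + qsum n h.
Proof. intros H. rewrite <- qsum_plus. now apply qsum_ext. Qed.

(* Write [4 a b = (a + b)^2 - (a - b)^2]; shears match the off-diagonal parts of the two sums,
   so that only the diagonals [a = b] and [x = y] survive. *)
Lemma odd_odd_convolution_even (n : nat) : Z.even (Z.of_nat n) = true ->
  4 * qsum n (fun a b x y => if Z.odd x && Z.odd y then sgn b * (a * b) else 0) =
  - (Z.of_nat n * vcoef n).
Proof.
  intros En.
  set (O1 := fun a b x y => if Z.odd x && Z.odd y then sgn b * ((a + b) * (a + b)) else 0).
  set (O2 := fun a b x y => if Z.odd x && Z.odd y then sgn b * ((a - b) * (a - b)) else 0).
  (* The meeting point of the two shears: a part of [T] shears to the part [y < x] of [O1], and the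
     part [a < b] of [O2] shears to a part of [T]. The evenness of [n] supplies the parity of [b]
     and the equality of the signs. *)
  set (T := fun a b x y : Z => if Z.even x && Z.odd y && Z.even b then sgn a * (b * b) else 0).
  set (Tab := qsum n (fun a b x y => if a <? b then T a b x y else 0)).
  set (Txy := qsum n (fun a b x y => if y <? x then T a b x y else 0)).
  assert (H12 : qsum n O1 = qsum n (fun a b x y => 4 *
      (if Z.odd x && Z.odd y then sgn b * (a * b) else 0)) + qsum n O2).
  { apply qsum_split. intros. unfold O1, O2. destruct (Z.odd x && Z.odd y); ring. }
  rewrite qsum_scal in H12.
  assert (P1 : qsum n (fun a b x y => if y <? x then O1 a b x y else 0) = Tab).
  { unfold Tab. rewrite qsum_shear. apply qsum_ext. intros a b x y _ _ _ _ E.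
    destruct (y <? x); [|reflexivity]. unfold O1, T, sgn. parity_of E. rewrite En in *.
    parity_cases a b x y. }
  (* With [n] even and [x], [y] odd, [a] and [b] have the same parity, so the swap preserves the
     sign factor. *)
  assert (P1' : qsum n (fun a b x y => if x <? y then O1 a b x y else 0) = Tab).
  { rewrite <- P1, qsum_swap. apply qsum_ext. intros a b x y _ _ _ _ E.
    destruct (y <? x); [|reflexivity]. unfold O1, sgn. parity_of E. rewrite En in *.
    parity_cases a b x y. }
  assert (P2 : qsum n (fun a b x y => if a <? b then O2 a b x y else 0) = Txy).
  { unfold Txy. rewrite qsum_shear. apply qsum_ext. intros a b x y _ _ _ _ E.
    destruct (y <? x); [|reflexivity]. unfold O2, T, sgn. parity_of E. rewrite En in *.
    parity_cases a b x y. }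
  assert (P2' : qsum n (fun a b x y => if b <? a then O2 a b x y else 0) = Txy).
  { rewrite <- P2, qsum_swap. apply qsum_ext. intros a b x y _ _ _ _ E.
    destruct (a <? b); [|reflexivity]. unfold O2, sgn. parity_of E. rewrite En in *.
    parity_cases a b x y. }
  assert (P2d : qsum n (fun a b x y => if a =? b then O2 a b x y else 0) = 0).
  { transitivity (qsum n (fun _ _ _ _ => 0 * 0)); [|rewrite qsum_scal; lia].
    apply qsum_ext. intros a b x y _ _ _ _ _.
    destruct (Z.eqb_spec a b); [|reflexivity]. subst. unfold O2.
    destruct (Z.odd x && Z.odd y); ring. }
  (* As [b] and [x] are even on the support of [T], replacing [a] by [a + b] and [y] by [y - x] does
     not change its value. Comparing both trichotomies of [T] then yields [Txy = Tab] plus the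
     diagonal [a = b] of [T]. *)
  assert (P3 : qsum n (fun a b x y => if b <? a then T a b x y else 0) =
               qsum n (fun a b x y => if x <? y then T a b x y else 0)).
  { rewrite qsum_shear_right. apply qsum_ext. intros a b x y _ _ _ _ E.
    destruct (x <? y); [|reflexivity]. unfold T, sgn. parity_cases a b x y. }
  assert (P3d : qsum n (fun a b x y => if x =? y then T a b x y else 0) = 0).
  { transitivity (qsum n (fun _ _ _ _ => 0 * 0)); [|rewrite qsum_scal; lia].
    apply qsum_ext. intros a b x y _ _ _ _ _.
    destruct (Z.eqb_spec x y); [|reflexivity]. subst. unfold T.
    rewrite <- Z.negb_even. destruct (Z.even y); reflexivity. }
  pose proof (qsum_trichotomy_xy n O1) as E1. pose proof (qsum_trichotomy_ab n O2) as E2.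
  pose proof (qsum_trichotomy_xy n T) as E3. pose proof (qsum_trichotomy_ab n T) as E4.
  fold Tab in E4. fold Txy in E3.
  rewrite P1, P1' in E1. rewrite P2, P2', P2d in E2.
  rewrite (qsum_diag_xy n O1) in E1. rewrite (qsum_diag_ab n T) in E4.
  (* Only factorisations [d z = n] with [z] odd, hence [d] even, contribute: [- d^2] from [O1] and
     [d^2 (z - 1)] from twice [T], with difference [- d^2 z = - n d]. *)
  assert (D : fsum n (fun d z => zsum (fun a => O1 a (d - a) z z) (zrange (d - 1)))
      + - (1) * (2 * fsum n (fun d z => zsum (fun x => T d d x (z - x)) (zrange (z - 1))))
      = - Z.of_nat n * vcoef n).
  { unfold vcoef. rewrite <- !fsum_scal, <- fsum_plus. apply fsum_ext. intros d z Hd Hz E.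
    assert (E' := E). parity_of E'. rewrite En in *.
    destruct (Z.odd z) eqn:Oz.
    - assert (Ed : Z.even d = true).
      { rewrite <- Z.negb_even in Oz. destruct (Z.even d), (Z.even z); easy. }
      rewrite (zsum_ext _ (fun a => (d * d) * sgn (d - a))).
      2: { intros a _. unfold O1. rewrite Oz. cbn. ring. }
      rewrite zsum_scal, sgn_sum by assumption.
      rewrite (zsum_ext (fun x => T d d x (z - x)) (fun x => (d * d) * (if Z.even x && Z.odd (z - x) then 1 else 0))).
      2: { intros x _. unfold T, sgn. rewrite Ed. destruct (Z.even x && Z.odd (z - x)); cbn [andb]; ring. }
      rewrite zsum_scal. pose proof (even_odd_count z Hz) as Hc. rewrite Oz in Hc.
      rewrite <- E. nia.
    - rewrite (zsum_ext _ (fun a => 0 * 0)), zsum_scal.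
      2: { intros a _. unfold O1. rewrite Oz. reflexivity. }
      rewrite (zsum_ext (fun x => T d d x (z - x)) (fun x => (d * d * sgn d * (if Z.even d then 1 else 0)) * (if Z.even x && Z.odd (z - x) then 1 else 0))).
      2: { intros x _. unfold T, sgn. destruct (Z.even x && Z.odd (z - x)), (Z.even d); cbn [andb]; ring. }
      rewrite zsum_scal. pose proof (even_odd_count z Hz) as Hc. rewrite Oz in Hc. nia. }
  lia.
Qed.

(** For odd [n] the swap changes the sign of every nonzero term, so the sum is its own negative; the
    factor [1 + sgn n] vanishes accordingly. *)
Lemma odd_odd_convolution (n : nat) :
  8 * qsum n (fun a b x y => if Z.odd x && Z.odd y then sgn b * (a * b) else 0) =
  - (Z.of_nat n * ((1 + sgn (Z.of_nat n)) * vcoef n)).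
Proof.
  unfold sgn at 2. destruct (Z.even (Z.of_nat n)) eqn:En.
  - pose proof (odd_odd_convolution_even n En). lia.
  - set (f := fun a b x y => if Z.odd x && Z.odd y then sgn b * (a * b) else 0).
    assert (H : qsum n f = -1 * qsum n f); [|lia].
    rewrite <- qsum_scal, qsum_swap at 1. apply qsum_ext. intros a b x y _ _ _ _ E.
    unfold f, sgn. parity_of E. rewrite En in *. parity_cases a b x y.
Qed.

(** Again [4 a b] is a difference of squares, but the parity condition is not symmetric under the
    swap. The two halves of each sum shear to different summands, [T] and [h]; the remaining halves
    of [T] shear to [k], the swap of [h]. The trichotomies of [T] and [h] then eliminate all
    off-diagonal parts. *)
Lemma odd_even_convolution (n : nat) :
  8 * qsum n (fun a b x y => if Z.odd x && Z.even y then sgn b * (a * b) else 0) =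
  vcoef n + Z.of_nat n * wcoef n - Z.of_nat n * vcoef n.
Proof.
  set (M1 := fun a b x y => if Z.odd x && Z.even y then sgn b * ((a + b) * (a + b)) else 0).
  set (M2 := fun a b x y => if Z.odd x && Z.even y then sgn b * ((a - b) * (a - b)) else 0).
  set (T := fun a b x y : Z => if Z.odd x && Z.even y then sgn (a + b) * (b * b) else 0).
  set (h := fun a b x y : Z => if Z.odd x && Z.odd y then sgn b * (a * a) else 0).
  set (k := fun a b x y : Z => if Z.odd x && Z.odd y then sgn a * (b * b) else 0).
  assert (H12 : qsum n M1 = qsum n (fun a b x y => 4 *
      (if Z.odd x && Z.even y then sgn b * (a * b) else 0)) + qsum n M2).
  { apply qsum_split. intros. unfold M1, M2. destruct (Z.odd x && Z.even y); ring. }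
  rewrite qsum_scal in H12.
  assert (P1 : qsum n (fun a b x y => if y <? x then M1 a b x y else 0) =
               qsum n (fun a b x y => if a <? b then T a b x y else 0)).
  { rewrite qsum_shear. apply qsum_ext. intros a b x y _ _ _ _ E.
    destruct (y <? x); [|reflexivity]. unfold M1, T, sgn. parity_cases a b x y. }
  assert (P1' : qsum n (fun a b x y => if x <? y then M1 a b x y else 0) =
                qsum n (fun a b x y => if b <? a then h a b x y else 0)).
  { rewrite qsum_shear_right. apply qsum_ext. intros a b x y _ _ _ _ E.
    destruct (x <? y); [|reflexivity]. unfold M1, h, sgn. parity_cases a b x y. }
  assert (P1d : qsum n (fun a b x y => if x =? y then M1 a b x y else 0) = 0).
  { transitivity (qsum n (fun _ _ _ _ => 0 * 0)); [|rewrite qsum_scal; lia].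
    apply qsum_ext. intros a b x y _ _ _ _ _.
    destruct (Z.eqb_spec x y); [|reflexivity]. subst. unfold M1.
    rewrite <- Z.negb_even. destruct (Z.even y); reflexivity. }
  assert (P2 : qsum n (fun a b x y => if a <? b then M2 a b x y else 0) =
               qsum n (fun a b x y => if y <? x then T a b x y else 0)).
  { rewrite qsum_shear. apply qsum_ext. intros a b x y _ _ _ _ E.
    destruct (y <? x); [|reflexivity]. unfold M2, T, sgn. parity_cases a b x y. }
  assert (P2' : qsum n (fun a b x y => if b <? a then M2 a b x y else 0) =
                qsum n (fun a b x y => if x <? y then h a b x y else 0)).
  { rewrite qsum_shear_right. apply qsum_ext. intros a b x y _ _ _ _ E.
    destruct (x <? y); [|reflexivity]. unfold M2, h, sgn. parity_cases a b x y. }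
  assert (P2d : qsum n (fun a b x y => if a =? b then M2 a b x y else 0) = 0).
  { transitivity (qsum n (fun _ _ _ _ => 0 * 0)); [|rewrite qsum_scal; lia].
    apply qsum_ext. intros a b x y _ _ _ _ _.
    destruct (Z.eqb_spec a b); [|reflexivity]. subst. unfold M2.
    destruct (Z.odd x && Z.even y); ring. }
  assert (P3 : qsum n (fun a b x y => if b <? a then T a b x y else 0) =
               qsum n (fun a b x y => if x <? y then k a b x y else 0)).
  { rewrite qsum_shear_right. apply qsum_ext. intros a b x y _ _ _ _ E.
    destruct (x <? y); [|reflexivity]. unfold T, k, sgn. parity_cases a b x y. }
  assert (P3' : qsum n (fun a b x y => if x <? y then T a b x y else 0) =
                qsum n (fun a b x y => if b <? a then k a b x y else 0)).
  { rewrite qsum_shear_right. apply qsum_ext. intros a b x y _ _ _ _ E.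
    destruct (x <? y); [|reflexivity]. unfold T, k, sgn. parity_cases a b x y. }
  assert (P3d : qsum n (fun a b x y => if x =? y then T a b x y else 0) = 0).
  { transitivity (qsum n (fun _ _ _ _ => 0 * 0)); [|rewrite qsum_scal; lia].
    apply qsum_ext. intros a b x y _ _ _ _ _.
    destruct (Z.eqb_spec x y); [|reflexivity]. subst. unfold T.
    rewrite <- Z.negb_even. destruct (Z.even y); reflexivity. }
  assert (P4 : qsum n (fun a b x y => if b <? a then k a b x y else 0) =
               qsum n (fun a b x y => if a <? b then h a b x y else 0)).
  { rewrite qsum_swap. apply qsum_ext. intros a b x y _ _ _ _ _.
    unfold h, k. rewrite Bool.andb_comm. reflexivity. }
  assert (P5 : qsum n (fun a b x y => if x <? y then k a b x y else 0) =
               qsum n (fun a b x y => if y <? x then h a b x y else 0)).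
  { rewrite qsum_swap. apply qsum_ext. intros a b x y _ _ _ _ _.
    unfold h, k. rewrite Bool.andb_comm. reflexivity. }
  pose proof (qsum_trichotomy_xy n M1) as E1. pose proof (qsum_trichotomy_ab n M2) as E2.
  pose proof (qsum_trichotomy_xy n T) as E3. pose proof (qsum_trichotomy_ab n T) as E4.
  pose proof (qsum_trichotomy_xy n h) as E5. pose proof (qsum_trichotomy_ab n h) as E6.
  rewrite (qsum_diag_ab n T) in E4. rewrite (qsum_diag_xy n h) in E5.
  rewrite (qsum_diag_ab n h) in E6.
  (* What survives is the diagonal [x = y] of [h] minus the diagonals [a = b] of [h] and [T]. After
     doubling, a factorisation [d z = n] contributes [d - n d] if [z] is odd and [- n sgn d d] if
     [z] is even. *)
  assert (D : fsum n (fun d z => 2 * zsum (fun a => h a (d - a) z z) (zrange (d - 1)))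
      + - (1) * fsum n (fun d z => 2 * zsum (fun x => h d d x (z - x)) (zrange (z - 1)))
      + - (1) * fsum n (fun d z => 2 * zsum (fun x => T d d x (z - x)) (zrange (z - 1)))
      = vcoef n + Z.of_nat n * wcoef n + - Z.of_nat n * vcoef n).
  { unfold vcoef, wcoef. rewrite <- !fsum_scal, <- !fsum_plus. apply fsum_ext. intros d z Hd Hz E.
    rewrite (zsum_ext (fun a => h a (d - a) z z)
      (fun a => (if Z.odd z then 1 else 0) * (sgn (d - a) * (a * a)))).
    2: { intros a _. unfold h. destruct (Z.odd z); cbn [andb]; ring. }
    rewrite (zsum_ext (fun x => h d d x (z - x))
      (fun x => (sgn d * (d * d)) * (if Z.odd x && Z.odd (z - x) then 1 else 0))).
    2: { intros x _. unfold h. destruct (Z.odd x && Z.odd (z - x)); ring. }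
    rewrite (zsum_ext (fun x => T d d x (z - x))
      (fun x => (d * d) * (if Z.odd x && Z.even (z - x) then 1 else 0))).
    2: { intros x _. unfold T. rewrite sgn_add. unfold sgn.
         destruct (Z.odd x && Z.even (z - x)), (Z.even d); ring. }
    rewrite !zsum_scal.
    pose proof (odd_odd_count z Hz) as H1. pose proof (odd_even_count z Hz) as H2.
    pose proof (sgn_square_sum d Hd) as H3. rewrite <- E. clear E.
    match goal with |- 2 * (?i * ?s3) + -(1) * (2 * (?K * ?s1)) + -(1) * (2 * (?D * ?s2)) = _ =>
      transitivity (i * (2 * s3) - K * (2 * s1) - D * (2 * s2)); [ring|rewrite H1, H2, H3] end.
    rewrite <- Z.negb_even. destruct (Z.even z); cbn [negb]; ring. }
  rewrite !fsum_scal in D. lia.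
Qed.

(** * Linear relations among the divisor sums, growth bounds, coefficient form of the Halphen
    equations *)

Lemma fsum_filter (n : nat) (c : Z -> Z -> bool) (f : Z -> Z -> Z) :
  fsum n (fun a x => if c a x then f a x else 0) =
  zsum (fun p => f (fst p) (snd p)) (filter (fun p => c (fst p) (snd p)) (factors n)).
Proof. rewrite zsum_filter. reflexivity. Qed.

Lemma double_half (c : Z) : Z.even c = true -> 2 * (c / 2) = c.
Proof. intros H. apply Zeven_bool_iff in H. rewrite (Zeven_div2 c H) at 2. rewrite Z.div2_div. reflexivity. Qed.

(** A factor [2] moves from [c] to [e]: the pairs [(2 c, e)] and [(c, 2 e)] correspond. *)
Lemma fsum_even_left (n : nat) :
  fsum n (fun c _ => if Z.even c then c else 0) = 2 * scoef n.
Proof.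
  unfold scoef. rewrite <- fsum_scal.
  rewrite (fsum_ext n (fun c e => 2 * (if Z.even e then c else 0))
             (fun c e => if Z.even e then 2 * c else 0)).
  2: { intros c e _ _ _. destruct (Z.even e); reflexivity. }
  rewrite (fsum_filter n (fun c _ => Z.even c) (fun c _ => c)).
  rewrite (fsum_filter n (fun _ e => Z.even e) (fun c _ => 2 * c)).
  apply (zsum_reindex (fun p => (fst p / 2, 2 * snd p)) (fun p => (2 * fst p, snd p / 2)));
    try apply NoDup_filter, NoDup_factors;
    intros [c e] H; rewrite filter_In, in_factors in H; cbn [fst snd] in *;
    rewrite filter_In, in_factors; cbn [fst snd]; destruct H as [H E];
    pose proof (double_half _ E); rewrite Z.even_mul; cbn [Z.even orb];
    repeat split; try nia; f_equal; try lia.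
  - rewrite Z.mul_comm. apply Z.div_mul. lia.
  - rewrite Z.mul_comm. apply Z.div_mul. lia.
Qed.

(** This relation links the three roots to [E2]: as series it says
    [V(x) + V(-x) - W(x) = 3 S(x)]. *)
Lemma wcoef_vcoef_scoef (n : nat) :
  wcoef n = (1 + sgn (Z.of_nat n)) * vcoef n - 3 * scoef n.
Proof.
  pose proof (fsum_even_left n) as HK.
  set (K := fsum n (fun c _ => if Z.even c then c else 0)) in HK.
  unfold sgn at 1. destruct (Z.even (Z.of_nat n)) eqn:En.
  (* In this form the identity holds term by term, case by case in the parities of [c] and [e];
     [K = 2 scoef n] finishes. *)
  - assert (H : wcoef n + 2 * K = scoef n + 2 * vcoef n); [|lia].
    unfold wcoef, K, scoef, vcoef. rewrite <- !fsum_scal, <- !fsum_plus.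
    apply fsum_ext. intros c e _ _ E. parity_of E. rewrite En in *.
    unfold sgn. rewrite <- Z.negb_even.
    destruct (Z.even c), (Z.even e); cbn [orb negb] in *; try discriminate; ring.
  - assert (H : forall g, fsum n (fun c e => if Z.even e then g c else 0) = 0).
    { intros g. rewrite (fsum_ext n _ (fun _ _ => 0 * 0)), fsum_scal; [lia|].
      intros c e _ _ E. parity_of E. rewrite En in *.
      destruct (Z.even c), (Z.even e); cbn [orb negb] in *; try discriminate; reflexivity. }
    unfold wcoef, scoef. rewrite (H (fun c => - (sgn c * c))), (H (fun c => c)). lia.
Qed.

Lemma sgn_vcoef (n : nat) :
  sgn (Z.of_nat n) * vcoef n = fsum n (fun c e => if Z.odd e then sgn c * c else 0).
Proof.
  unfold vcoef. rewrite <- fsum_scal. apply fsum_ext. intros c e _ _ E. parity_of E.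
  unfold sgn. rewrite <- Z.negb_even, <- H.
  destruct (Z.even c), (Z.even e); cbn [orb negb]; ring.
Qed.

Lemma scoef_odd (m : nat) : scoef (2 * m + 1) = 0.
Proof.
  unfold scoef. rewrite (fsum_ext _ _ (fun _ _ => 0 * 0)), fsum_scal; [lia|].
  intros c e _ _ E. destruct (Z.even e) eqn:Ee; [|reflexivity].
  apply double_half in Ee. nia.
Qed.

(** An even cofactor in [c e = 2 m] is [2 e'] with [c e' = m], so [c] runs over the divisors of
    [m]. *)
Lemma scoef_even (m : nat) : scoef (2 * m) = Z.of_nat (sigma1 m).
Proof.
  assert (H : Z.of_nat (sigma1 m) =
    zsum Z.of_nat (filter (fun d => Nat.eqb (Nat.modulo m d) 0) (seq 1 m))).
  { unfold sigma1. induction (filter _ _) as [|d l IH]; [reflexivity|].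
    cbn [fold_right zsum]. rewrite Nat2Z.inj_add, IH. reflexivity. }
  rewrite H. unfold scoef.
  rewrite (fsum_filter _ (fun _ e => Z.even e) (fun c _ => c)).
  apply (zsum_reindex (fun p => Z.to_nat (fst p))
    (fun d => (Z.of_nat d, 2 * Z.of_nat (m / d)))).
  - apply NoDup_filter, NoDup_factors.
  - apply NoDup_filter, seq_NoDup.
  - intros [c e] Hp. rewrite filter_In, in_factors in Hp. cbn [fst snd] in *.
    destruct Hp as [(H1 & H2 & H3) E]. pose proof (double_half _ E) as E'.
    assert (Hm : m = (Z.to_nat c * Z.to_nat (e / 2))%nat) by (apply Nat2Z.inj; nia).
    assert (Hd : (m / Z.to_nat c)%nat = Z.to_nat (e / 2)).
    { rewrite Hm, Nat.mul_comm. apply Nat.div_mul. lia. }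
    rewrite Hd. repeat split; [|f_equal; nia|nia].
    rewrite filter_In, in_seq, Nat.eqb_eq. split; [nia|].
    rewrite Hm, Nat.mul_comm. apply Nat.Div0.mod_mul.
  - intros d Hd. rewrite filter_In, in_seq, Nat.eqb_eq in Hd. destruct Hd as [Hd E].
    cbn [fst snd]. split; [|lia].
    pose proof (Nat.div_mod_eq m d). rewrite filter_In, in_factors. cbn [snd].
    rewrite Z.even_mul. split; [|reflexivity].
    assert (1 <= m / d)%nat by nia. nia.
Qed.

Lemma zsum_bound {A : Type} (f : A -> Z) (l : list A) (M : Z) :
  (forall x, In x l -> Z.abs (f x) <= M) -> Z.abs (zsum f l) <= M * Z.of_nat (length l).
Proof.
  induction l as [|x l IH]; intros H; cbn [zsum fold_right length]; [lia|].
  specialize (IH (fun y Hy => H y (or_intror Hy))). specialize (H x (or_introl eq_refl)).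
  unfold zsum in IH. lia.
Qed.

(** A crude count, at most [n^2] pairs with terms of size at most [n]; any polynomial bound gives
    convergence on the unit disc. *)
Lemma fsum_bound (n : nat) (g : Z -> Z -> Z) :
  (forall a x, 1 <= a -> 1 <= x -> Z.abs (g a x) <= a) ->
  Z.abs (fsum n g) <= Z.of_nat n * Z.of_nat n * Z.of_nat n.
Proof.
  intros H. transitivity (Z.of_nat n * Z.of_nat (length (factors n))).
  - apply zsum_bound. intros [a x] Hp. apply in_factors in Hp. cbn [fst snd].
    specialize (H a x). nia.
  - assert (L : (length (factors n) <= n * n)%nat).
    { unfold factors. eapply Nat.le_trans; [apply filter_length_le|].
      rewrite length_prod. unfold zrange. rewrite length_map, length_seq, Nat2Z.id. lia. }
    nia.
Qed.

Lemma vcoef_bound (n : nat) : Z.abs (vcoef n) <= Z.of_nat n * Z.of_nat n * Z.of_nat n.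
Proof. apply fsum_bound. intros a x Ha _. destruct (Z.odd x); lia. Qed.

Lemma wcoef_bound (n : nat) : Z.abs (wcoef n) <= Z.of_nat n * Z.of_nat n * Z.of_nat n.
Proof. apply fsum_bound. intros a x Ha _. unfold sgn. destruct (Z.even x), (Z.even a); lia. Qed.

Lemma scoef_bound (n : nat) : Z.abs (scoef n) <= Z.of_nat n * Z.of_nat n * Z.of_nat n.
Proof. apply fsum_bound. intros a x Ha _. destruct (Z.even x); lia. Qed.

(** The [n]-th coefficient of [8 V(x) V(-x)]. *)
Lemma sgn_vcoef_convolution (n : nat) :
  8 * zsum (fun k => vcoef k * (sgn (Z.of_nat (n - k)) * vcoef (n - k))) (seq 0 (S n)) =
  - (Z.of_nat n * ((1 + sgn (Z.of_nat n)) * vcoef n)).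
Proof.
  rewrite <- odd_odd_convolution. f_equal.
  rewrite (qsum_ext n _ (fun a b x y =>
    (if Z.odd x then a else 0) * (if Z.odd y then sgn b * b else 0))).
  2: { intros. destruct (Z.odd x), (Z.odd y); cbn [andb]; ring. }
  rewrite (qsum_convolution n (fun a x => if Z.odd x then a else 0)
             (fun b y => if Z.odd y then sgn b * b else 0)).
  apply zsum_ext. intros k _. rewrite sgn_vcoef. reflexivity.
Qed.

Lemma vcoef_wcoef_convolution (n : nat) :
  8 * zsum (fun k => vcoef k * wcoef (n - k)) (seq 0 (S n)) =
  Z.of_nat n * vcoef n - vcoef n - Z.of_nat n * wcoef n.
Proof.
  transitivity (- (8 * qsum n (fun a b x y => if Z.odd x && Z.even y then sgn b * (a * b) else 0)));
    [|rewrite odd_even_convolution; ring].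
  transitivity (8 * (-1 * qsum n (fun a b x y => if Z.odd x && Z.even y then sgn b * (a * b) else 0)));
    [|ring].
  f_equal. rewrite <- qsum_scal.
  rewrite (qsum_ext n _ (fun a b x y =>
    (if Z.odd x then a else 0) * (if Z.even y then - (sgn b * b) else 0))).
  2: { intros. destruct (Z.odd x), (Z.even y); cbn [andb]; ring. }
  rewrite (qsum_convolution n (fun a x => if Z.odd x then a else 0)
             (fun b y => if Z.even y then - (sgn b * b) else 0)).
  reflexivity.
Qed.

Lemma sgn_wcoef (n : nat) : sgn (Z.of_nat n) * wcoef n = wcoef n.
Proof.
  unfold sgn. destruct (Z.even (Z.of_nat n)) eqn:En; [lia|].
  unfold wcoef. rewrite (fsum_ext n _ (fun _ _ => 0 * 0)), fsum_scal; [lia|].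
  intros c e _ _ E. parity_of E. rewrite En in *.
  destruct (Z.even c), (Z.even e); cbn [orb negb] in *; try discriminate; reflexivity.
Qed.

(** The preceding convolution under [x |-> -x], which fixes the even series [W]. *)
Lemma sgn_vcoef_wcoef_convolution (n : nat) :
  8 * zsum (fun k => (sgn (Z.of_nat k) * vcoef k) * wcoef (n - k)) (seq 0 (S n)) =
  Z.of_nat n * (sgn (Z.of_nat n) * vcoef n) - sgn (Z.of_nat n) * vcoef n - Z.of_nat n * wcoef n.
Proof.
  transitivity (sgn (Z.of_nat n) *
    (8 * zsum (fun k => vcoef k * wcoef (n - k)) (seq 0 (S n)))).
  - transitivity (8 * (sgn (Z.of_nat n) * zsum (fun k => vcoef k * wcoef (n - k)) (seq 0 (S n))));
      [|ring].
    f_equal. rewrite <- zsum_scal. apply zsum_ext. intros k Hk. apply in_seq in Hk.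
    rewrite <- (sgn_wcoef (n - k)) at 1.
    replace (Z.of_nat n) with (Z.of_nat k + Z.of_nat (n - k)) by lia. rewrite sgn_add.
    unfold sgn. destruct (Z.even (Z.of_nat k)), (Z.even (Z.of_nat (n - k))); ring.
  - rewrite vcoef_wcoef_convolution. rewrite <- (sgn_wcoef n) at 2. ring.
Qed.

Close Scope Z_scope.
Close Scope bool_scope.
Open Scope C_scope.

(** * Complex power series on the unit disc *)

Definition disc_summable (a : nat -> C) : Prop :=
  forall r : R, (0 <= r < 1)%R -> ex_series (fun n => Cmod (a n) * r ^ n)%R.

(** Given by two real series, so that real Cauchy products and real power series along rays apply
    componentwise. *)
Definition CPS (a : nat -> C) (x : C) : C :=
  (Series (fun n => Re (a n * Cpow x n)), Series (fun n => Im (a n * Cpow x n))).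

Lemma Cmod_pow (x : C) (n : nat) : Cmod (Cpow x n) = (Cmod x ^ n)%R.
Proof.
  induction n as [|n IH]; simpl; [apply Cmod_1|]. rewrite Cmod_mult, IH. reflexivity.
Qed.

Lemma Rabs_Im_le (z : C) : (Rabs (Im z) <= Cmod z)%R.
Proof. eapply Rle_trans; [|apply (Rmax_Cmod z)]. apply Rmax_r. Qed.

Lemma sum_n_Re (a : nat -> C) (n : nat) :
  Re (sum_n (G := C_AbelianMonoid) a n) = sum_n (fun k => Re (a k)) n.
Proof.
  induction n as [|n IH]; [rewrite !sum_O; reflexivity|].
  rewrite !sum_Sn. rewrite <- IH. reflexivity.
Qed.

Lemma sum_n_Im (a : nat -> C) (n : nat) :
  Im (sum_n (G := C_AbelianMonoid) a n) = sum_n (fun k => Im (a k)) n.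
Proof.
  induction n as [|n IH]; [rewrite !sum_O; reflexivity|].
  rewrite !sum_Sn. rewrite <- IH. reflexivity.
Qed.

(** The balls of [C_NormedModule] are products of real balls, so componentwise convergence is
    convergence. *)
Lemma is_series_C (a : nat -> C) (l1 l2 : R) :
  is_series (fun n => Re (a n)) l1 -> is_series (fun n => Im (a n)) l2 ->
  is_series (K := C_AbsRing) (V := C_NormedModule) a (l1, l2).
Proof.
  intros H1 H2. unfold is_series in *.
  apply filterlim_locally. intros eps.
  pose proof (proj1 (filterlim_locally _ _) H1 eps) as B1.
  pose proof (proj1 (filterlim_locally _ _) H2 eps) as B2.
  generalize (filter_and _ _ B1 B2). apply filter_imp. intros n [C1 C2].
  rewrite <- sum_n_Re in C1. rewrite <- sum_n_Im in C2. split; [exact C1|exact C2].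
Qed.

Lemma is_series_C_unique (a : nat -> C) (l l' : C) :
  is_series (K := C_AbsRing) (V := C_NormedModule) a l ->
  is_series (K := C_AbsRing) (V := C_NormedModule) a l' -> l = l'.
Proof. intros H H'. exact (filterlim_locally_unique _ _ _ H H'). Qed.

Lemma disc_term (a : nat -> C) (x : C) :
  disc_summable a -> (Cmod x < 1)%R -> ex_series (fun n => Cmod (a n * Cpow x n)).
Proof.
  intros Ha Hx. eapply ex_series_ext; [|apply (Ha (Cmod x)); split; [apply Cmod_ge_0|exact Hx]].
  intros n. rewrite Cmod_mult, Cmod_pow. reflexivity.
Qed.

Lemma disc_Re (a : nat -> C) (x : C) : disc_summable a -> (Cmod x < 1)%R ->
  ex_series (fun n => Rabs (Re (a n * Cpow x n))).
Proof.
  intros Ha Hx. apply (ex_series_le (K := R_AbsRing) (V := R_CompleteNormedModule) _ (fun n => Cmod (a n * Cpow x n))).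
  - intros n. change (Rabs (Rabs (Re (a n * Cpow x n))) <= Cmod (a n * Cpow x n))%R.
    rewrite Rabs_Rabsolu. apply re_le_Cmod.
  - now apply disc_term.
Qed.

Lemma disc_Im (a : nat -> C) (x : C) : disc_summable a -> (Cmod x < 1)%R ->
  ex_series (fun n => Rabs (Im (a n * Cpow x n))).
Proof.
  intros Ha Hx. apply (ex_series_le (K := R_AbsRing) (V := R_CompleteNormedModule) _ (fun n => Cmod (a n * Cpow x n))).
  - intros n. change (Rabs (Rabs (Im (a n * Cpow x n))) <= Cmod (a n * Cpow x n))%R.
    rewrite Rabs_Rabsolu. apply Rabs_Im_le.
  - now apply disc_term.
Qed.

Lemma is_series_CPS (a : nat -> C) (x : C) : disc_summable a -> (Cmod x < 1)%R ->
  is_series (K := C_AbsRing) (V := C_NormedModule) (fun n => a n * Cpow x n) (CPS a x).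
Proof.
  intros Ha Hx. apply is_series_C; apply Series_correct, ex_series_Rabs.
  - now apply disc_Re.
  - now apply disc_Im.
Qed.

Lemma CPS_unique (a : nat -> C) (x l : C) : disc_summable a -> (Cmod x < 1)%R ->
  is_series (K := C_AbsRing) (V := C_NormedModule) (fun n => a n * Cpow x n) l -> CPS a x = l.
Proof. intros Ha Hx H. eapply is_series_C_unique; [|exact H]. now apply is_series_CPS. Qed.

Lemma CPS_ext (a b : nat -> C) (x : C) : (forall n, a n = b n) -> CPS a x = CPS b x.
Proof.
  intros H. unfold CPS. f_equal; apply Series_ext; intros n; rewrite H; reflexivity.
Qed.

Lemma disc_summable_le (a : nat -> C) (b : nat -> R) :
  (forall n, (Cmod (a n) <= b n)%R) ->
  (forall r, (0 <= r < 1)%R -> ex_series (fun n => b n * r ^ n)%R) -> disc_summable a.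
Proof.
  intros H Hb r Hr.
  apply (ex_series_le (K := R_AbsRing) (V := R_CompleteNormedModule) _ (fun n => b n * r ^ n)%R); auto.
  intros n. change (Rabs (Cmod (a n) * r ^ n) <= b n * r ^ n)%R.
  pose proof (pow_le r n (proj1 Hr)). rewrite Rabs_pos_eq.
  - apply Rmult_le_compat_r; auto.
  - apply Rmult_le_pos; [apply Cmod_ge_0|assumption].
Qed.

Lemma disc_summable_plus (a b : nat -> C) :
  disc_summable a -> disc_summable b -> disc_summable (fun n => a n + b n).
Proof.
  intros Ha Hb. apply (disc_summable_le _ (fun n => Cmod (a n) + Cmod (b n))%R).
  - intros n. apply Cmod_triangle.
  - intros r Hr. eapply ex_series_ext; [|apply (ex_series_plus (V := R_NormedModule) _ _ (Ha r Hr) (Hb r Hr))].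
    intros n. change (Cmod (a n) * r ^ n + Cmod (b n) * r ^ n = (Cmod (a n) + Cmod (b n)) * r ^ n)%R. ring.
Qed.

Lemma disc_summable_scal (c : C) (a : nat -> C) :
  disc_summable a -> disc_summable (fun n => c * a n).
Proof.
  intros Ha. apply (disc_summable_le _ (fun n => Cmod c * Cmod (a n))%R).
  - intros n. rewrite Cmod_mult. apply Rle_refl.
  - intros r Hr. eapply ex_series_ext; [|apply (ex_series_scal (V := R_NormedModule) (Cmod c) _ (Ha r Hr))].
    intros n. change (Cmod c * (Cmod (a n) * r ^ n) = Cmod c * Cmod (a n) * r ^ n)%R. ring.
Qed.

Lemma CPS_plus (a b : nat -> C) (x : C) : disc_summable a -> disc_summable b ->
  (Cmod x < 1)%R -> CPS (fun n => a n + b n) x = CPS a x + CPS b x.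
Proof.
  intros Ha Hb Hx. apply CPS_unique; [now apply disc_summable_plus|assumption|].
  eapply is_series_ext; [|apply (is_series_plus (V := C_NormedModule) _ _ _ _
    (is_series_CPS a x Ha Hx) (is_series_CPS b x Hb Hx))].
  intros n. change (a n * Cpow x n + b n * Cpow x n = (a n + b n) * Cpow x n). ring.
Qed.

Lemma CPS_scal (c : C) (a : nat -> C) (x : C) : disc_summable a ->
  (Cmod x < 1)%R -> CPS (fun n => c * a n) x = c * CPS a x.
Proof.
  intros Ha Hx. apply CPS_unique; [now apply disc_summable_scal|assumption|].
  eapply is_series_ext; [|apply (is_series_scal (V := C_NormedModule) c _ _
    (is_series_CPS a x Ha Hx))].
  intros n. change (c * (a n * Cpow x n) = c * a n * Cpow x n). ring.
Qed.

Definition cshift (a : nat -> C) (n : nat) : C := a (S n).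

Definition cdiff (a : nat -> C) (n : nat) : C := RtoC (INR (S n)) * a (S n).

(** Passing to the radius of convergence makes its invariance under [PS_derive] available for
    summability on the disc. *)
Lemma disc_summable_radius (b : nat -> R) : (forall n, (0 <= b n)%R) ->
  (forall r, (0 <= r < 1)%R -> ex_series (fun n => b n * r ^ n)%R) <-> Rbar_le 1 (CV_radius b).
Proof.
  intros Hb. split.
  - intros H. apply Rbar_not_lt_le. intros L.
    destruct (CV_radius b) as [c| |] eqn:E; simpl in L; try contradiction.
    + pose proof (CV_radius_ge_0 b) as P. rewrite E in P. simpl in P.
      assert (Hr : (0 <= (c + 1) / 2 < 1)%R) by lra.
      apply (CV_disk_outside b ((c + 1) / 2)).
      * rewrite E. simpl. rewrite Rabs_pos_eq; lra.
      * apply (ex_series_lim_0 (fun n => b n * ((c + 1) / 2) ^ n)%R). now apply H.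
    + pose proof (CV_radius_ge_0 b) as P. rewrite E in P. exact P.
  - intros H r Hr. apply ex_series_Rabs, CV_disk_inside.
    eapply Rbar_lt_le_trans; [|exact H]. simpl. rewrite Rabs_pos_eq; lra.
Qed.

Lemma summable_PS_derive (b : nat -> R) : (forall n, (0 <= b n)%R) ->
  (forall r, (0 <= r < 1)%R -> ex_series (fun n => b n * r ^ n)%R) ->
  forall r, (0 <= r < 1)%R -> ex_series (fun n => PS_derive b n * r ^ n)%R.
Proof.
  intros Hb H. apply disc_summable_radius.
  - intros n. unfold PS_derive. apply Rmult_le_pos; [apply pos_INR|apply Hb].
  - rewrite CV_radius_derive. now apply disc_summable_radius.
Qed.

Lemma disc_summable_cdiff (a : nat -> C) : disc_summable a -> disc_summable (cdiff a).
Proof.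
  intros Ha. apply (disc_summable_le _ (PS_derive (fun n => Cmod (a n)))).
  - intros n. unfold cdiff, PS_derive. rewrite Cmod_mult, Cmod_R, Rabs_pos_eq by apply pos_INR.
    apply Rle_refl.
  - apply summable_PS_derive; [intros; apply Cmod_ge_0|exact Ha].
Qed.

Lemma disc_summable_cshift (a : nat -> C) : disc_summable a -> disc_summable (cshift a).
Proof.
  intros Ha. apply (disc_summable_le _ (fun n => Cmod (cdiff a n))).
  - intros n. unfold cdiff, cshift. rewrite Cmod_mult, Cmod_R, Rabs_pos_eq by apply pos_INR.
    pose proof (Cmod_ge_0 (a (S n))). pose proof (pos_INR n). rewrite S_INR. nra.
  - now apply disc_summable_cdiff.
Qed.

(** The third derivative of the geometric series has coefficients [(n+1)(n+2)(n+3)], which dominate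
    [n^3]. *)
Lemma disc_summable_cubic (a : nat -> C) (M : R) :
  (forall n, Cmod (a n) <= M * (INR n * INR n * INR n))%R -> disc_summable a.
Proof.
  intros H.
  pose (b := PS_derive (PS_derive (PS_derive (fun _ => 1%R)))).
  assert (Hg : forall r, (0 <= r < 1)%R -> ex_series (fun n => 1 * r ^ n)%R).
  { intros r Hr. eapply ex_series_ext; [|apply (ex_series_geom r)].
    - intros n. simpl. ring.
    - rewrite Rabs_pos_eq; lra. }
  assert (Hp : forall c, (forall n, 0 <= c n)%R -> forall n, (0 <= PS_derive c n)%R).
  { intros c Hc n. apply Rmult_le_pos; [apply pos_INR|apply Hc]. }
  apply (disc_summable_le _ (fun n => Rabs M * b n)%R).
  - intros n. eapply Rle_trans; [apply H|].
    pose proof (pos_INR n). assert (0 <= INR n * INR n * INR n)%R by (repeat apply Rmult_le_pos; assumption).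
    apply Rle_trans with (Rabs M * (INR n * INR n * INR n))%R.
    + apply Rmult_le_compat_r; [assumption|apply Rle_abs].
    + apply Rmult_le_compat_l; [apply Rabs_pos|]. unfold b, PS_derive. rewrite !S_INR.
      set (t := INR n) in *. nra.
  - intros r Hr. eapply ex_series_ext;
      [|apply (ex_series_scal (V := R_NormedModule) (Rabs M) (fun n => b n * r ^ n)%R)].
    + intros n. change (Rabs M * (b n * r ^ n) = Rabs M * b n * r ^ n)%R. ring.
    + unfold b. revert r Hr. repeat apply summable_PS_derive; auto; intros; try lra.
      * apply Hp, Hp. intros; lra.
      * apply Hp. intros; lra.
Qed.

Lemma CPS_decr (a : nat -> C) (x : C) : disc_summable a -> (Cmod x < 1)%R ->
  CPS a x = a 0%nat + x * CPS (cshift a) x.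
Proof.
  intros Ha Hx. apply CPS_unique; [assumption..|].
  apply (is_series_decr_1 (V := C_NormedModule)).
  pose proof (is_series_scal (V := C_NormedModule) x _ _
    (is_series_CPS _ x (disc_summable_cshift a Ha) Hx)) as H.
  match goal with |- is_series _ ?l => replace l with (scal (K := C_AbsRing) (V := C_NormedModule) x (CPS (cshift a) x)) end.
  - eapply is_series_ext; [|exact H]. intros n.
    change (x * (a (S n) * Cpow x n) = a (S n) * (x * Cpow x n)). ring.
  - change (x * CPS (cshift a) x = (a 0%nat + x * CPS (cshift a) x) + - (a 0%nat * 1)). ring.
Qed.

Lemma CPS_theta (a : nat -> C) (x : C) : disc_summable a -> (Cmod x < 1)%R ->
  CPS (fun n => RtoC (INR n) * a n) x = x * CPS (cdiff a) x.
Proof.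
  intros Ha Hx. rewrite CPS_decr; try assumption.
  - unfold cdiff, cshift. simpl. ring.
  - intros r Hr.
    apply (ex_series_incr_1 (V := R_NormedModule)).
    eapply ex_series_ext; [|apply (ex_series_scal (V := R_NormedModule) r _ (disc_summable_cdiff a Ha r Hr))].
    intros n. unfold cdiff. change (r * (Cmod (RtoC (INR (S n)) * a (S n)) * r ^ n) =
      Cmod (RtoC (INR (S n)) * a (S n)) * (r * r ^ n))%R. ring.
Qed.

(** The real and imaginary parts of the product combine four real Cauchy products, all of absolutely
    convergent series. *)
Lemma CPS_mult (a b c : nat -> C) (x : C) :
  disc_summable a -> disc_summable b -> disc_summable c -> (Cmod x < 1)%R ->
  (forall n, c n = sum_n (G := C_AbelianMonoid) (fun k => a k * b (n - k)%nat) n) ->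
  CPS c x = CPS a x * CPS b x.
Proof.
  intros Ha Hb Hc Hx Hconv. apply CPS_unique; [assumption..|].
  set (A := fun n => a n * Cpow x n). set (B := fun n => b n * Cpow x n).
  assert (E : forall n, c n * Cpow x n =
    sum_n (G := C_AbelianMonoid) (fun k => A k * B (n - k)%nat) n).
  { intros n. rewrite Hconv.
    transitivity (sum_n (G := C_AbelianMonoid) (fun k => (Cpow x n) * (a k * b (n - k)%nat)) n).
    - rewrite (sum_n_mult_l (K := C_Ring)). apply Cmult_comm.
    - apply sum_n_ext_loc. intros k Hk. unfold A, B.
      replace n with (k + (n - k))%nat at 1 by lia. rewrite Cpow_add_r.
      match goal with |- ?l = ?r => change (@eq C l r) end. ring. }
  assert (SA1 : is_series (fun n => Re (A n)) (Re (CPS a x)))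
    by (apply Series_correct, ex_series_Rabs, disc_Re; assumption).
  assert (SA2 : is_series (fun n => Im (A n)) (Im (CPS a x)))
    by (apply Series_correct, ex_series_Rabs, disc_Im; assumption).
  assert (SB1 : is_series (fun n => Re (B n)) (Re (CPS b x)))
    by (apply Series_correct, ex_series_Rabs, disc_Re; assumption).
  assert (SB2 : is_series (fun n => Im (B n)) (Im (CPS b x)))
    by (apply Series_correct, ex_series_Rabs, disc_Im; assumption).
  pose proof (disc_Re a x Ha Hx) as RA1. pose proof (disc_Im a x Ha Hx) as RA2.
  pose proof (disc_Re b x Hb Hx) as RB1. pose proof (disc_Im b x Hb Hx) as RB2.
  pose proof (is_series_mult _ _ _ _ SA1 SB1 RA1 RB1) as M11.
  pose proof (is_series_mult _ _ _ _ SA2 SB2 RA2 RB2) as M22.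
  pose proof (is_series_mult _ _ _ _ SA1 SB2 RA1 RB2) as M12.
  pose proof (is_series_mult _ _ _ _ SA2 SB1 RA2 RB1) as M21.
  rewrite (surjective_pairing (CPS a x * CPS b x)).
  apply is_series_C.
  - eapply is_series_ext; [|exact (is_series_minus (V := R_NormedModule) _ _ _ _ M11 M22)].
    intros n. rewrite E, sum_n_Re, sum_n_Reals. unfold minus, plus, opp; simpl.
    change (sum_f_R0 (fun k => Re (A k) * Re (B (n - k)%nat)) n - sum_f_R0 (fun k => Im (A k) * Im (B (n - k)%nat)) n = sum_f_R0 (fun k => Re (A k * B (n - k)%nat)) n)%R.
    rewrite <- minus_sum. apply sum_eq. intros k _. reflexivity.
  - eapply is_series_ext; [|exact (is_series_plus (V := R_NormedModule) _ _ _ _ M12 M21)].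
    intros n. rewrite E, sum_n_Im, sum_n_Reals.
    change (sum_f_R0 (fun k => Re (A k) * Im (B (n - k)%nat)) n + sum_f_R0 (fun k => Im (A k) * Re (B (n - k)%nat)) n = sum_f_R0 (fun k => Im (A k * B (n - k)%nat)) n)%R.
    rewrite <- plus_sum. apply sum_eq. intros k _. reflexivity.
Qed.

Lemma Cmod_sum_n_le (u : nat -> C) (b : nat -> R) (n : nat) :
  (forall k, Cmod (u k) <= b k)%R -> (Cmod (sum_n (G := C_AbelianMonoid) u n) <= sum_n b n)%R.
Proof.
  intros H. induction n as [|n IH]; [rewrite !sum_O; apply H|].
  rewrite !sum_Sn. eapply Rle_trans; [apply Cmod_triangle|].
  apply Rplus_le_compat; auto.
Qed.

Lemma is_series_C_norm_le (u : nat -> C) (b : nat -> R) (l : C) (s : R) :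
  is_series (K := C_AbsRing) (V := C_NormedModule) u l -> is_series b s ->
  (forall n, Cmod (u n) <= b n)%R -> (Cmod l <= s)%R.
Proof.
  intros Hu Hb H.
  apply (is_lim_seq_le (fun n => Cmod (sum_n (G := C_AbelianMonoid) u n)) (fun n => sum_n b n)
    (Finite (Cmod l)) (Finite s)).
  - intros n. now apply Cmod_sum_n_le.
  - exact (filterlim_comp _ _ _ _ _ _ _ _ Hu (filterlim_norm (K := C_AbsRing) (V := C_NormedModule) l)).
  - exact Hb.
Qed.

(** * Complex differentiability of power series, by explicit quadratic remainders *)

Lemma is_derive_quadratic (f : C -> C) (x l : C) (K d : R) : (0 < d)%R -> (0 <= K)%R ->
  (forall y, (Cmod (y - x) < d)%R ->
     (Cmod (f y - f x - (y - x) * l) <= K * (Cmod (y - x) * Cmod (y - x)))%R) ->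
  is_derive (K := C_AbsRing) (V := C_NormedModule) f x l.
Proof.
  intros Hd HK H. split; [apply is_linear_scal_l|].
  intros x' Hx'. rewrite <- (is_filter_lim_locally_unique (V := AbsRing_NormedModule C_AbsRing) x x' Hx').
  intros eps. pose proof (cond_pos eps) as He.
  assert (Hd' : (0 < Rmin d (eps / (K + 1)))%R).
  { apply Rmin_pos; [assumption|]. apply Rdiv_lt_0_compat; lra. }
  exists (mkposreal _ Hd'). intros y Hy.
  change (Cmod (y - x) < Rmin d (eps / (K + 1)))%R in Hy.
  change (Cmod (f y - f x - (y - x) * l) <= eps * Cmod (y - x))%R.
  eapply Rle_trans; [apply H; eapply Rlt_le_trans; [exact Hy|apply Rmin_l]|].
  pose proof (Cmod_ge_0 (y - x)) as Hp.
  rewrite <- Rmult_assoc. apply Rmult_le_compat_r; [assumption|].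
  assert (Hy' : (Cmod (y - x) <= eps / (K + 1))%R).
  { left. eapply Rlt_le_trans; [exact Hy|apply Rmin_r]. }
  apply Rle_trans with ((K + 1) * (eps / (K + 1)))%R.
  - apply Rmult_le_compat; lra.
  - right. field. lra.
Qed.

(** The remainders [R_n] of [x^n] satisfy [R_(n+1) = y R_n + n x^(n-1) (y-x)^2]; the coefficients in
    the bound are those of a second derivative. *)
Lemma Cpow_taylor_bound (x y : C) (r : R) (n : nat) :
  (Cmod x <= r)%R -> (Cmod y <= r)%R ->
  (Cmod (Cpow y (S (S n)) - Cpow x (S (S n)) - RtoC (INR (S (S n))) * Cpow x (S n) * (y - x))
   <= INR (S (S n)) * INR (S n) * r ^ n * (Cmod (y - x) * Cmod (y - x)))%R.
Proof.
  intros Hx Hy. induction n as [|n IH].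
  - replace (Cpow y 2 - Cpow x 2 - RtoC (INR 2) * Cpow x 1 * (y - x))
      with ((y - x) * (y - x)).
    2: { rewrite !S_INR, !RtoC_plus. simpl. ring. }
    rewrite Cmod_mult. pose proof (Cmod_ge_0 (y - x)). simpl. nra.
  - set (P := Cpow y (S (S n)) - Cpow x (S (S n)) - RtoC (INR (S (S n))) * Cpow x (S n) * (y - x)) in IH.
    replace (Cpow y (S (S (S n))) - Cpow x (S (S (S n))) -
      RtoC (INR (S (S (S n)))) * Cpow x (S (S n)) * (y - x))
      with (y * P + RtoC (INR (S (S n))) * Cpow x (S n) * ((y - x) * (y - x))).
    2: { unfold P. rewrite (S_INR (S (S n))), RtoC_plus. simpl Cpow. ring. }
    eapply Rle_trans; [apply Cmod_triangle|].
    rewrite !Cmod_mult, Cmod_R, Cmod_pow, Rabs_pos_eq by apply pos_INR.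
    pose proof (Cmod_ge_0 (y - x)) as Hd. pose proof (Cmod_ge_0 x) as Hx0.
    assert (Hr : (0 <= r)%R) by lra.
    set (D := (Cmod (y - x) * Cmod (y - x))%R) in *.
    assert (HD : (0 <= D)%R) by (unfold D; nra).
    assert (H1 : (Cmod y * Cmod P <= r * (INR (S (S n)) * INR (S n) * r ^ n * D))%R).
    { apply Rmult_le_compat; auto; apply Cmod_ge_0. }
    assert (H2 : (Cmod x ^ S n <= r ^ S n)%R) by (apply pow_incr; split; assumption).
    assert (H3 : (INR (S (S n)) * Cmod x ^ S n * D <= INR (S (S n)) * r ^ S n * D)%R).
    { apply Rmult_le_compat_r; [assumption|]. apply Rmult_le_compat_l; [apply pos_INR|assumption]. }
    eapply Rle_trans; [apply Rplus_le_compat; [exact H1|exact H3]|].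
    assert (H4 : (0 <= INR (S (S n)) * r ^ S n * D)%R).
    { repeat apply Rmult_le_pos; auto using pos_INR, pow_le. }
    rewrite (S_INR (S (S n))). simpl pow in *.
    assert (H5 : (INR (S (S n)) = INR (S n) + 1)%R) by apply S_INR.
    rewrite H5 in *. nra.
Qed.

(** The termwise Taylor remainders are dominated by the twice differentiated series of moduli at a
    radius halfway between [|x|] and [1]. *)
Lemma is_derive_CPS (a : nat -> C) (x : C) : disc_summable a -> (Cmod x < 1)%R ->
  is_derive (K := C_AbsRing) (V := C_NormedModule) (CPS a) x (CPS (cdiff a) x).
Proof.
  intros Ha Hx. pose proof (Cmod_ge_0 x) as Hx0.
  set (r := ((1 + Cmod x) / 2)%R). assert (Hr : (0 <= r < 1)%R) by (unfold r; lra).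
  set (b := PS_derive (PS_derive (fun n => Cmod (a n)))).
  assert (Hb0 : forall c : nat -> R, (forall n, 0 <= c n)%R -> forall n, (0 <= PS_derive c n)%R).
  { intros c Hc n. apply Rmult_le_pos; [apply pos_INR|apply Hc]. }
  assert (Hb : ex_series (fun n => b n * r ^ n)%R).
  { cut (forall r1, (0 <= r1 < 1)%R -> ex_series (fun n => b n * r1 ^ n)%R); [auto|]. unfold b.
    apply summable_PS_derive; [apply Hb0; intros; apply Cmod_ge_0|].
    apply summable_PS_derive; [intros; apply Cmod_ge_0|exact Ha]. }
  apply (is_derive_quadratic _ _ _ (Rabs (Series (fun n => b n * r ^ n)%R)) ((1 - Cmod x) / 2)).
  - lra.
  - apply Rabs_pos.
  - intros y Hy.
    assert (Hyr : (Cmod y <= r)%R).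
    { replace y with (x + (y - x)) by ring. eapply Rle_trans; [apply Cmod_triangle|]. unfold r. lra. }
    assert (Hy1 : (Cmod y < 1)%R) by lra.
    assert (Hxr : (Cmod x <= r)%R) by (unfold r; lra).
    assert (S0 : is_series (K := C_AbsRing) (V := C_NormedModule)
      (fun n => a n * (Cpow y n - Cpow x n)) (CPS a y - CPS a x)).
    { eapply is_series_ext; [|exact (is_series_minus (V := C_NormedModule) _ _ _ _
        (is_series_CPS a y Ha Hy1) (is_series_CPS a x Ha Hx))].
      intros n. change (a n * Cpow y n - a n * Cpow x n = a n * (Cpow y n - Cpow x n)). ring. }
    assert (S1 : is_series (K := C_AbsRing) (V := C_NormedModule)
      (fun n => a (S n) * (Cpow y (S n) - Cpow x (S n))) (CPS a y - CPS a x)).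
    { apply (is_series_incr_1 (V := C_NormedModule) (fun n => a n * (Cpow y n - Cpow x n))).
      match goal with |- is_series _ ?l => replace l with (CPS a y - CPS a x) end; [exact S0|].
      change (CPS a y - CPS a x = CPS a y - CPS a x + a 0%nat * (1 - 1)). ring. }
    assert (S2 : is_series (K := C_AbsRing) (V := C_NormedModule)
      (fun n => a (S n) * (Cpow y (S n) - Cpow x (S n) - RtoC (INR (S n)) * Cpow x n * (y - x)))
      (CPS a y - CPS a x - (y - x) * CPS (cdiff a) x)).
    { eapply is_series_ext; [|exact (is_series_minus (V := C_NormedModule) _ _ _ _ S1
        (is_series_scal (V := C_NormedModule) (y - x) _ _
          (is_series_CPS _ x (disc_summable_cdiff a Ha) Hx)))].
      intros n. unfold cdiff.
      change (a (S n) * (Cpow y (S n) - Cpow x (S n)) -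
        (y - x) * (RtoC (INR (S n)) * a (S n) * Cpow x n) =
        a (S n) * (Cpow y (S n) - Cpow x (S n) - RtoC (INR (S n)) * Cpow x n * (y - x))). ring. }
    (* The remainders of [x^0] and [x^1] vanish; dropping these two terms aligns the index with that
       of the second derivative. *)
    assert (S3 : is_series (K := C_AbsRing) (V := C_NormedModule)
      (fun n => a (S (S n)) * (Cpow y (S (S n)) - Cpow x (S (S n)) -
         RtoC (INR (S (S n))) * Cpow x (S n) * (y - x)))
      (CPS a y - CPS a x - (y - x) * CPS (cdiff a) x)).
    { apply (is_series_incr_1 (V := C_NormedModule) (fun n =>
        a (S n) * (Cpow y (S n) - Cpow x (S n) - RtoC (INR (S n)) * Cpow x n * (y - x)))).
      match goal with |- is_series _ ?l => replace l with
        (CPS a y - CPS a x - (y - x) * CPS (cdiff a) x) end; [exact S2|].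
      change (CPS a y - CPS a x - (y - x) * CPS (cdiff a) x =
        CPS a y - CPS a x - (y - x) * CPS (cdiff a) x +
        a 1%nat * (y * 1 - x * 1 - 1 * 1 * (y - x))). ring. }
    eapply Rle_trans; [|apply Rmult_le_compat_r; [apply Rmult_le_pos; apply Cmod_ge_0|apply Rle_abs]].
    apply (is_series_C_norm_le _ _ _ _ S3 (is_series_scal_r _ _ _ (Series_correct _ Hb))).
    intros n. rewrite Cmod_mult.
    eapply Rle_trans; [apply Rmult_le_compat_l; [apply Cmod_ge_0|apply Cpow_taylor_bound; eassumption]|].
    unfold b, PS_derive. right. ring.
Qed.

(** * Restriction to rays and non-vanishing *)

Lemma CV_radius_ge (p : nat -> R) (rho : R) : (0 <= rho)%R ->
  ex_series (fun n => p n * rho ^ n)%R -> Rbar_le rho (CV_radius p).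
Proof.
  intros Hr H. apply Rbar_not_lt_le. intros L. apply (CV_disk_outside p rho).
  - rewrite Rabs_pos_eq; assumption.
  - now apply (ex_series_lim_0 (fun n => p n * rho ^ n)%R).
Qed.

Lemma Re_RtoC_mult (r : R) (z : C) : Re (RtoC r * z) = (r * Re z)%R.
Proof. unfold Re, RtoC, Cmult; simpl. ring. Qed.

Lemma Im_RtoC_mult (r : R) (z : C) : Im (RtoC r * z) = (r * Im z)%R.
Proof. unfold Im, RtoC, Cmult; simpl. ring. Qed.

Lemma ray_term (a : nat -> C) (x : C) (s : R) (n : nat) :
  a n * Cpow (RtoC s * x) n = RtoC (s ^ n) * (a n * Cpow x n).
Proof.
  assert (E : Cpow (RtoC s * x) n = RtoC (s ^ n) * Cpow x n).
  { induction n as [|n IH]; simpl; [ring|]. rewrite IH, RtoC_mult. ring. }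
  rewrite E. ring.
Qed.

Lemma CPS_ray (a : nat -> C) (x : C) (s : R) :
  CPS a (RtoC s * x) =
  (PSeries (fun n => Re (a n * Cpow x n)) s, PSeries (fun n => Im (a n * Cpow x n)) s).
Proof.
  unfold CPS, PSeries. f_equal; apply Series_ext; intros n; rewrite ray_term.
  - unfold Re, Im, Cmult, RtoC; simpl. ring.
  - unfold Re, Im, Cmult, RtoC; simpl. ring.
Qed.

Lemma CPS_bound (b : nat -> C) (x y : C) : disc_summable b -> (Cmod x < 1)%R ->
  (Cmod y <= Cmod x)%R -> (Cmod (CPS b y) <= Series (fun n => Cmod (b n) * Cmod x ^ n))%R.
Proof.
  intros Hb Hx Hy.
  apply (is_series_C_norm_le (fun n => b n * Cpow y n) (fun n => Cmod (b n) * Cmod x ^ n)%R).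
  - apply is_series_CPS; [assumption|lra].
  - apply Series_correct, Hb. split; [apply Cmod_ge_0|assumption].
  - intros n. rewrite Cmod_mult, Cmod_pow. apply Rmult_le_compat_l; [apply Cmod_ge_0|].
    apply pow_incr. split; [apply Cmod_ge_0|assumption].
Qed.

(* Gronwall along the segment from [0] to [x]: if [f' = h f] and [|x h| <= M], then
   [|f (s x)|^2 exp (2 M s)] is nondecreasing in [s]. *)
Lemma CPS_nonzero (a b : nat -> C) : disc_summable a -> disc_summable b -> a 0%nat <> 0 ->
  (forall x : C, x <> 0 -> (Cmod x < 1)%R -> CPS (cdiff a) x = CPS b x * CPS a x) ->
  forall x : C, (Cmod x < 1)%R -> CPS a x <> 0.
Proof.
  intros Ha Hb H0 Hode x Hx.
  assert (Ha0 : CPS a 0 = a 0%nat).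
  { rewrite CPS_decr; [ring|assumption|]. rewrite Cmod_0. lra. }
  destruct (Ceq_dec x 0) as [->|Nx]; [now rewrite Ha0|].
  pose proof (Cmod_gt_0 x) as Px. apply proj1 in Px. specialize (Px Nx).
  set (p := fun n => Re (a n * Cpow x n)). set (q := fun n => Im (a n * Cpow x n)).
  (* Chosen with [1 < rho] and [rho |x| < 1]: the ray series in [s] then converge beyond [s = 1], so
     the endpoint can be included in the mean value argument. *)
  set (rho := ((1 + / Cmod x) / 2)%R).
  assert (Hi : (1 < / Cmod x)%R).
  { rewrite <- Rinv_1. apply Rinv_lt_contravar; lra. }
  assert (Hrho : (1 < rho)%R) by (unfold rho; lra).
  assert (Hrx : (Cmod (RtoC rho * x) < 1)%R).
  { rewrite Cmod_mult, Cmod_R, Rabs_pos_eq by lra. unfold rho.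
    apply Rlt_le_trans with (/ Cmod x * Cmod x)%R; [|right; field; lra].
    apply Rmult_lt_compat_r; lra. }
  assert (Rp : Rbar_lt 1 (CV_radius p)).
  { eapply Rbar_lt_le_trans; [|apply (CV_radius_ge p rho)]; [exact Hrho|lra|].
    eapply ex_series_ext; [|apply ex_series_Rabs, (disc_Re a (RtoC rho * x) Ha Hrx)].
    intros n. cbv beta. rewrite ray_term. unfold p, Re, Im, Cmult, RtoC; simpl. ring. }
  assert (Rq : Rbar_lt 1 (CV_radius q)).
  { eapply Rbar_lt_le_trans; [|apply (CV_radius_ge q rho)]; [exact Hrho|lra|].
    eapply ex_series_ext; [|apply ex_series_Rabs, (disc_Im a (RtoC rho * x) Ha Hrx)].
    intros n. cbv beta. rewrite ray_term. unfold q, Re, Im, Cmult, RtoC; simpl. ring. }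
  set (M := Series (fun n => Cmod (b n) * Cmod x ^ n)%R).
  set (P := PSeries p). set (Q := PSeries q).
  set (P' := PSeries (PS_derive p)). set (Q' := PSeries (PS_derive q)).
  assert (DP : forall s, (0 <= s <= 1)%R -> is_derive P s (P' s)).
  { intros s Hs. apply is_derive_PSeries. eapply Rbar_le_lt_trans; [|exact Rp].
    simpl. rewrite Rabs_pos_eq; lra. }
  assert (DQ : forall s, (0 <= s <= 1)%R -> is_derive Q s (Q' s)).
  { intros s Hs. apply is_derive_PSeries. eapply Rbar_le_lt_trans; [|exact Rq].
    simpl. rewrite Rabs_pos_eq; lra. }
  assert (Hf : forall s, CPS a (RtoC s * x) = (P s, Q s)) by (intros s; apply CPS_ray).
  assert (Hsx : forall s, (0 <= s <= 1)%R -> (Cmod (RtoC s * x) <= Cmod x)%R).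
  { intros s Hs. rewrite Cmod_mult, Cmod_R, Rabs_pos_eq by lra. nra. }
  assert (Hf' : forall s, (0 <= s <= 1)%R -> x * CPS (cdiff a) (RtoC s * x) = (P' s, Q' s)).
  { intros s Hs. specialize (Hsx s Hs). rewrite <- CPS_scal; [|now apply disc_summable_cdiff|lra].
    rewrite CPS_ray. f_equal; apply PSeries_ext; intros n; unfold PS_derive, p, q, cdiff.
    - transitivity (Re (RtoC (INR (S n)) * (a (S n) * (x * Cpow x n)))); [f_equal; ring|apply Re_RtoC_mult].
    - transitivity (Im (RtoC (INR (S n)) * (a (S n) * (x * Cpow x n)))); [f_equal; ring|apply Im_RtoC_mult]. }
  set (psi := fun s => ((P s * P s + Q s * Q s) * exp (2 * M * s))%R).
  set (psi' := fun s => (2 * (P s * P' s + Q s * Q' s) * exp (2 * M * s) +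
     (P s * P s + Q s * Q s) * (2 * M * exp (2 * M * s)))%R).
  destruct (MVT_cor2 psi psi' 0 1) as [c [Hc Hc01]]; [lra| |].
  { intros s Hs. apply is_derive_Reals. unfold psi, psi'.
    specialize (DP s Hs). specialize (DQ s Hs).
    auto_derive.
    - repeat split; try (exists (P' s); exact DP); try (exists (Q' s); exact DQ).
    - replace (Derive (fun x0 => P x0) s) with (P' s) by (symmetry; apply is_derive_unique; exact DP).
      replace (Derive (fun x0 => Q x0) s) with (Q' s) by (symmetry; apply is_derive_unique; exact DQ).
      ring. }
  assert (Hpos : (0 <= psi' c)%R).
  { assert (Hc' : (0 <= c <= 1)%R) by lra.
    pose proof (Hf' c Hc') as E. pose proof (Hsx c Hc') as Hcx.
    rewrite Hode, Hf in E; [| |lra].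
    (* The differential equation is assumed only off [0]; the intermediate point [c] is strictly
       positive. *)
    2: { apply Cmult_neq_0; [intros Z; apply RtoC_inj in Z; lra|assumption]. }
    assert (HM : (Cmod (x * CPS b (RtoC c * x)) <= M)%R).
    { rewrite Cmod_mult. pose proof (CPS_bound b x (RtoC c * x) Hb Hx Hcx) as HB.
      fold M in HB. pose proof (Cmod_ge_0 (CPS b (RtoC c * x))). nra. }
    set (z := x * CPS b (RtoC c * x)) in *.
    assert (E' : z * (P c, Q c) = (P' c, Q' c)) by (rewrite <- E; unfold z; ring).
    clearbody z.
    pose proof (f_equal Re E') as E1. pose proof (f_equal Im E') as E2.
    unfold Re, Im, Cmult in E1, E2. simpl in E1, E2. fold (Re z) (Im z) in *.
    assert (Hz : (- M <= Re z)%R).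
    { pose proof (re_le_Cmod z). pose proof (Rle_abs (- Re z)) as Z. rewrite Rabs_Ropp in Z. lra. }
    unfold psi'. rewrite <- E1, <- E2.
    match goal with |- (0 <= ?e)%R => replace e with
      (2 * (P c * P c + Q c * Q c) * (Re z + M) * exp (2 * M * c))%R by (unfold Re; ring) end.
    pose proof (exp_pos (2 * M * c)).
    apply Rmult_le_pos; [|lra]. apply Rmult_le_pos; [nra|lra]. }
  assert (Hpsi0 : (0 < psi 0)%R).
  { unfold psi. rewrite Rmult_0_r, exp_0, Rmult_1_r.
    pose proof (Hf 0%R) as E. replace (RtoC 0 * x) with (RtoC 0) in E by ring. rewrite Ha0 in E.
    destruct (Req_dec (P 0%R) 0) as [Z1|Z1]; [|nra].
    destruct (Req_dec (Q 0%R) 0) as [Z2|Z2]; [|nra].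
    exfalso. apply H0. rewrite E, Z1, Z2. reflexivity. }
  intros Z. pose proof (Hf 1%R) as E. replace (RtoC 1 * x) with x in E by ring. rewrite Z in E.
  assert (Hpsi1 : psi 1%R = 0%R).
  { unfold psi. pose proof (f_equal fst E) as E1. pose proof (f_equal snd E) as E2.
    simpl in E1, E2. rewrite <- E1, <- E2. ring. }
  lra.
Qed.

(** * The exponential and the nome *)

Lemma Rabs_sin_le (t : R) : (Rabs (sin t) <= Rabs t)%R.
Proof.
  destruct (MVT_gen sin 0 t cos) as [c [_ E]].
  - intros; apply is_derive_Reals, derivable_pt_lim_sin.
  - intros; apply continuity_sin.
  - rewrite sin_0 in E. replace (sin t) with (cos c * t)%R by lra.
    rewrite Rabs_mult. pose proof (COS_bound c). pose proof (Rabs_pos t).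
    assert (Rabs (cos c) <= 1)%R by (apply Rabs_le; lra). nra.
Qed.

Lemma one_minus_cos_bound (t : R) : (0 <= 1 - cos t <= t * t / 2)%R.
Proof.
  split; [pose proof (COS_bound t); lra|].
  replace t with (2 * (t / 2))%R at 1 by field. rewrite cos_2a_sin.
  pose proof (Rabs_sin_le (t / 2)) as H. apply Rsqr_le_abs_1 in H. unfold Rsqr in H. nra.
Qed.

Lemma sin_minus_id_bound (t : R) : (Rabs t <= 1)%R -> (Rabs (sin t - t) <= t * t)%R.
Proof.
  intros Ht. destruct (MVT_gen (fun s => sin s - s)%R 0 t (fun s => cos s - 1)%R) as [c [Hc E]].
  - intros; auto_derive; [exact I|ring].
  - intros; apply continuity_pt_minus; [apply continuity_sin|apply continuity_pt_id].
  - rewrite sin_0 in E. replace (sin t - t)%R with ((cos c - 1) * t)%R by lra.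
    rewrite Rabs_mult. pose proof (one_minus_cos_bound c) as Hb.
    replace (Rabs (cos c - 1)) with (1 - cos c)%R.
    2: { rewrite Rabs_minus_sym, Rabs_pos_eq; lra. }
    assert (Hct : (c * c <= t * t)%R).
    { apply (Rsqr_le_abs_1 c t). unfold Rmin, Rmax, Rabs in *. repeat destruct Rle_dec; repeat destruct Rcase_abs; lra. }
    assert (Rabs t * Rabs t = t * t)%R by (rewrite <- Rabs_mult; apply Rabs_pos_eq; nra).
    pose proof (Rabs_pos t). nra.
Qed.

Lemma exp_taylor_bound (t : R) : (Rabs t <= 1 / 2)%R -> (0 <= exp t - 1 - t <= 2 * (t * t))%R.
Proof.
  intros Ht. assert (Ht' : (- (1 / 2) <= t <= 1 / 2)%R) by (split; [|apply Rle_trans with (Rabs t); [apply Rle_abs|lra]];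
    pose proof (Rle_abs (- t)) as Z; rewrite Rabs_Ropp in Z; lra).
  pose proof (exp_ineq1_le t). pose proof (exp_ineq1_le (- t)) as H1. split; [lra|].
  pose proof (exp_pos t) as Hp. assert (E : (exp t * exp (- t) = 1)%R).
  { rewrite <- exp_plus, Rplus_opp_r. apply exp_0. }
  assert (H2 : (exp t * (1 - t) <= 1)%R) by nra.
  nra.
Qed.

Lemma Cmod_le_Rabs (z : C) : (Cmod z <= Rabs (Re z) + Rabs (Im z))%R.
Proof.
  unfold Cmod. pose proof (Rabs_pos (Re z)). pose proof (Rabs_pos (Im z)).
  rewrite <- (sqrt_Rsqr (Rabs (Re z) + Rabs (Im z))) by lra.
  apply sqrt_le_1_alt. unfold Rsqr. fold (Re z) (Im z).
  rewrite <- (pow2_abs (Re z)), <- (pow2_abs (Im z)). nra.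
Qed.

Lemma Cmod_sqr (z : C) : (Cmod z * Cmod z = Re z * Re z + Im z * Im z)%R.
Proof. unfold Cmod. rewrite sqrt_sqrt; unfold Re, Im; nra. Qed.

Lemma cexp_plus (z w : C) : cexp (z + w) = cexp z * cexp w.
Proof.
  unfold cexp, Cplus, Cmult, Re, Im; simpl. rewrite exp_plus, cos_plus, sin_plus.
  f_equal; ring.
Qed.

Lemma Cmod_cexp (z : C) : Cmod (cexp z) = exp (Re z).
Proof.
  pose proof (exp_pos (Re z)).
  apply Rsqr_inj; [apply Cmod_ge_0|lra|]. unfold Rsqr at 1. rewrite Cmod_sqr.
  unfold cexp. simpl. pose proof (sin2_cos2 (Im z)) as E. unfold Rsqr in *.
  transitivity (exp (Re z) * exp (Re z) * (sin (Im z) * sin (Im z) + cos (Im z) * cos (Im z)))%R;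
    [ring|rewrite E; ring].
Qed.

Lemma cexp_taylor_bound (h : C) : (Cmod h < 1 / 2)%R ->
  (Cmod (cexp h - 1 - h) <= 8 * (Cmod h * Cmod h))%R.
Proof.
  intros Hh. pose proof (re_le_Cmod h) as Ha. pose proof (Rabs_Im_le h) as Hb.
  rewrite Cmod_sqr. eapply Rle_trans; [apply Cmod_le_Rabs|].
  set (a := Re h) in *. set (b := Im h) in *.
  (* Both parts are regrouped so that every summand is visibly of second order in [a] and [b]. *)
  assert (E1 : Re (cexp h - 1 - h) = ((exp a - 1 - a) * cos b + - ((1 + a) * (1 - cos b)))%R).
  { unfold cexp. fold a b. unfold a, b, Re, Im. simpl. ring. }
  assert (E2 : Im (cexp h - 1 - h) = ((exp a - 1) * sin b + (sin b - b))%R).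
  { unfold cexp. fold a b. unfold a, b, Re, Im. simpl. ring. }
  rewrite E1, E2.
  pose proof (exp_taylor_bound a ltac:(lra)) as He.
  pose proof (one_minus_cos_bound b) as Hc.
  pose proof (sin_minus_id_bound b ltac:(lra)) as Hs.
  pose proof (Rabs_sin_le b) as Hs'.
  pose proof (COS_bound b) as Cb.
  assert (Ha' : (- (1 / 2) <= a <= 1 / 2)%R).
  { split; [|apply Rle_trans with (Rabs a); [apply Rle_abs|lra]].
    pose proof (Rle_abs (- a)) as Z; rewrite Rabs_Ropp in Z; lra. }
  assert (Haa : (Rabs a * Rabs a = a * a)%R) by (rewrite <- Rabs_mult; apply Rabs_pos_eq; nra).
  assert (Hbb : (Rabs b * Rabs b = b * b)%R) by (rewrite <- Rabs_mult; apply Rabs_pos_eq; nra).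
  pose proof (Rabs_pos a). pose proof (Rabs_pos b).
  assert (T1 : (Rabs ((exp a - 1 - a) * cos b) <= 2 * (a * a))%R).
  { rewrite Rabs_mult, (Rabs_pos_eq (exp a - 1 - a)) by lra.
    assert (Rabs (cos b) <= 1)%R by (apply Rabs_le; lra). pose proof (Rabs_pos (cos b)). nra. }
  assert (T2 : (Rabs (- ((1 + a) * (1 - cos b))) <= b * b)%R).
  { rewrite Rabs_Ropp, Rabs_pos_eq by (apply Rmult_le_pos; lra). nra. }
  assert (T3 : (Rabs ((exp a - 1) * sin b) <= 2 * (Rabs a * Rabs b))%R).
  { rewrite Rabs_mult.
    assert (Rabs (exp a - 1) <= 2 * Rabs a)%R.
    { replace (exp a - 1)%R with ((exp a - 1 - a) + a)%R by ring.
      eapply Rle_trans; [apply Rabs_triang|]. rewrite (Rabs_pos_eq (exp a - 1 - a)) by lra.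
      assert (Rabs a * Rabs a <= 1 / 2 * Rabs a)%R by (apply Rmult_le_compat_r; lra). lra. }
    pose proof (Rabs_pos (exp a - 1)). pose proof (Rabs_pos (sin b)).
    apply Rle_trans with (2 * Rabs a * Rabs b)%R; [|lra]. apply Rmult_le_compat; assumption. }
  pose proof (Rabs_triang ((exp a - 1 - a) * cos b) (- ((1 + a) * (1 - cos b)))).
  pose proof (Rabs_triang ((exp a - 1) * sin b) (sin b - b)).
  pose proof (Rle_0_sqr (Rabs a - Rabs b)) as Hsq. unfold Rsqr in Hsq.
  assert (2 * (Rabs a * Rabs b) <= a * a + b * b)%R by lra.
  pose proof (Rle_0_sqr a) as Sa. pose proof (Rle_0_sqr b) as Sb. unfold Rsqr in Sa, Sb. lra.
Qed.

Lemma is_derive_cexp (z : C) :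
  is_derive (K := C_AbsRing) (V := C_NormedModule) cexp z (cexp z).
Proof.
  apply (is_derive_quadratic _ _ _ (8 * Cmod (cexp z)) (1 / 2)); [lra| |].
  - pose proof (Cmod_ge_0 (cexp z)). lra.
  - intros y Hy.
    replace (cexp y - cexp z - (y - z) * cexp z) with (cexp z * (cexp (y - z) - 1 - (y - z))).
    2: { replace y with (z + (y - z)) at 3 by ring. rewrite cexp_plus. ring. }
    rewrite Cmod_mult. pose proof (cexp_taylor_bound _ Hy) as H. pose proof (Cmod_ge_0 (cexp z)).
    nra.
Qed.

Definition pii : C := RtoC PI * Ci.

(** The square root of [q]: the series [V] contains odd powers of it. *)
Definition nome (tau : C) : C := cexp (pii * tau).

Lemma qnome_nome (tau : C) : qnome tau = nome tau * nome tau.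
Proof.
  unfold qnome, nome, pii. rewrite <- cexp_plus. f_equal. rewrite RtoC_mult. ring.
Qed.

Lemma Cmod_nome (tau : C) : in_H tau -> (Cmod (nome tau) < 1)%R.
Proof.
  unfold in_H, nome, pii. intros H. rewrite Cmod_cexp, <- exp_0. apply exp_increasing.
  pose proof PI_RGT_0. unfold Re, Im, Cmult, Ci, RtoC in *; simpl. nra.
Qed.

Lemma nome_neq_0 (tau : C) : nome tau <> 0.
Proof.
  intros E. pose proof (f_equal Cmod E) as H. unfold nome in H.
  rewrite Cmod_cexp, Cmod_0 in H. pose proof (exp_pos (Re (pii * tau))). lra.
Qed.

Lemma is_derive_Cmult_l (c z : C) :
  is_derive (K := C_AbsRing) (V := C_NormedModule) (fun t => c * t) z c.
Proof.
  apply (is_derive_quadratic _ _ _ 0 1); [lra|lra|]. intros y _.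
  replace (c * y - c * z - (y - z) * c) with (RtoC 0) by ring.
  rewrite Cmod_0. lra.
Qed.

(* Coquelicot has two normed-module structures on [C], with balls of different shapes;
   its chain and product rules refer to the one induced by [Cmod]. *)
Lemma is_derive_C_AbsRing (f : C -> C) (z l : C) :
  is_derive (K := C_AbsRing) (V := C_NormedModule) f z l <->
  is_derive (K := C_AbsRing) (V := AbsRing_NormedModule C_AbsRing) f z l.
Proof. split; intros [_ H]; (split; [apply is_linear_scal_l|exact H]). Qed.

Lemma is_derive_C_comp (f g : C -> C) (z df dg : C) :
  is_derive (K := C_AbsRing) (V := C_NormedModule) f (g z) df ->
  is_derive (K := C_AbsRing) (V := C_NormedModule) g z dg ->
  is_derive (K := C_AbsRing) (V := C_NormedModule) (fun t => f (g t)) z (dg * df).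
Proof. intros Hf Hg. exact (is_derive_comp (K := C_AbsRing) (V := C_NormedModule) f g z df dg Hf
  (proj1 (is_derive_C_AbsRing g z dg) Hg)). Qed.

Definition ctheta (a : nat -> C) (n : nat) : C := RtoC (INR n) * a n.

Lemma is_derive_CPS_nome (a : nat -> C) (tau : C) : disc_summable a -> in_H tau ->
  is_derive (K := C_AbsRing) (V := C_NormedModule) (fun t => CPS a (nome t)) tau
    (pii * CPS (ctheta a) (nome tau)).
Proof.
  intros Ha Ht. pose proof (Cmod_nome tau Ht) as Hx.
  unfold ctheta. rewrite CPS_theta by assumption. rewrite Cmult_assoc.
  apply is_derive_C_comp; [now apply is_derive_CPS|].
  exact (is_derive_C_comp cexp (fun t => pii * t) tau _ _ (is_derive_cexp _) (is_derive_Cmult_l _ _)).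
Qed.

(** * The Halphen system *)

Definition zc (f : nat -> Z) (n : nat) : C := RtoC (IZR (f n)).

(** Coefficients of [V(-x)]. *)
Definition mcoef (n : nat) : Z := (sgn (Z.of_nat n) * vcoef n)%Z.

Lemma disc_summable_zc (f : nat -> Z) :
  (forall n, Z.abs (f n) <= Z.of_nat n * Z.of_nat n * Z.of_nat n)%Z -> disc_summable (zc f).
Proof.
  intros H. apply (disc_summable_cubic _ 1). intros n. unfold zc.
  rewrite Cmod_R, <- abs_IZR, Rmult_1_l, INR_IZR_INZ, <- !mult_IZR. apply IZR_le, H.
Qed.

Lemma disc_vcoef : disc_summable (zc vcoef).
Proof. apply disc_summable_zc, vcoef_bound. Qed.

Lemma disc_wcoef : disc_summable (zc wcoef).
Proof. apply disc_summable_zc, wcoef_bound. Qed.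

Lemma disc_scoef : disc_summable (zc scoef).
Proof. apply disc_summable_zc, scoef_bound. Qed.

Lemma disc_mcoef : disc_summable (zc mcoef).
Proof.
  apply disc_summable_zc. intros n. unfold mcoef, sgn.
  pose proof (vcoef_bound n). destruct (Z.even (Z.of_nat n)); lia.
Qed.

Lemma disc_summable_ctheta (a : nat -> C) : disc_summable a -> disc_summable (ctheta a).
Proof.
  intros Ha r Hr. apply (ex_series_incr_1 (V := R_NormedModule)).
  eapply ex_series_ext; [|apply (ex_series_scal (V := R_NormedModule) r _ (disc_summable_cdiff a Ha r Hr))].
  intros n. change (r * (Cmod (RtoC (INR (S n)) * a (S n)) * r ^ n) =
    Cmod (RtoC (INR (S n)) * a (S n)) * (r * r ^ n))%R. ring.
Qed.

Lemma zc_convolution (f g : nat -> Z) (n : nat) :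
  RtoC (IZR (zsum (fun k => f k * g (n - k)%nat)%Z (seq 0 (S n)))) =
  sum_n (G := C_AbelianMonoid) (fun k => zc f k * zc g (n - k)%nat) n.
Proof.
  assert (H : forall m, RtoC (IZR (zsum (fun k => f k * g (n - k)%nat)%Z (seq 0 (S m)))) =
    sum_n (G := C_AbelianMonoid) (fun k => zc f k * zc g (n - k)%nat) m); [|apply H].
  unfold zc. induction m as [|m IH].
  - rewrite sum_O. cbn [seq zsum fold_right]. rewrite Z.add_0_r, mult_IZR, RtoC_mult. reflexivity.
  - rewrite sum_Sn, <- IH, seq_S, zsum_app. cbn [zsum fold_right].
    rewrite plus_IZR, RtoC_plus. f_equal. rewrite Z.add_0_r, mult_IZR, RtoC_mult. reflexivity.
Qed.

(** The factor [8] is the one in the integer convolution identities, kept in front to avoid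
    fractions in [Z]. *)
Lemma CPS_zc_mult (f g : nat -> Z) (c : nat -> C) (x : C) :
  disc_summable (zc f) -> disc_summable (zc g) -> disc_summable c -> (Cmod x < 1)%R ->
  (forall n, c n = RtoC (IZR (8 * zsum (fun k => f k * g (n - k)%nat)%Z (seq 0 (S n))))) ->
  CPS c x = RtoC 8 * (CPS (zc f) x * CPS (zc g) x).
Proof.
  intros Hf Hg Hc Hx H.
  assert (H8 : RtoC 8 <> 0) by (intros Z; apply RtoC_inj in Z; lra).
  rewrite <- (CPS_mult (zc f) (zc g) (fun n => / RtoC 8 * c n) x); auto.
  - rewrite CPS_scal by assumption. field; exact H8.
  - now apply disc_summable_scal.
  - intros n. rewrite <- zc_convolution, H, mult_IZR, RtoC_mult. field; exact H8.
Qed.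

Ltac disc :=
  cbv beta;
  lazymatch goal with
  | |- disc_summable (fun n => @?a n + @?b n) => apply (disc_summable_plus a b); disc
  | |- disc_summable (fun n => ?c * @?a n) => apply (disc_summable_scal c a); disc
  | |- disc_summable (fun n => ?a n) => change (disc_summable a); disc
  | |- disc_summable (ctheta ?a) => apply (disc_summable_ctheta a); disc
  | |- disc_summable (cshift ?a) => apply (disc_summable_cshift a); disc
  | |- disc_summable (zc vcoef) => exact disc_vcoef
  | |- disc_summable (zc wcoef) => exact disc_wcoef
  | |- disc_summable (zc mcoef) => exact disc_mcoef
  | |- disc_summable (zc scoef) => exact disc_scoef
  | |- disc_summable _ => assumption
  | |- (Cmod _ < 1)%R => assumption
  end.

Lemma halphen_VM (x : C) : (Cmod x < 1)%R ->
  RtoC 8 * (CPS (zc vcoef) x * CPS (zc mcoef) x) =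
  - (CPS (ctheta (zc vcoef)) x + CPS (ctheta (zc mcoef)) x).
Proof.
  intros Hx.
  rewrite <- (CPS_zc_mult _ _ (fun n => RtoC (-1) * (ctheta (zc vcoef) n + ctheta (zc mcoef) n)));
    try disc.
  - rewrite CPS_scal, CPS_plus by disc. ring.
  - intros n. unfold mcoef. rewrite sgn_vcoef_convolution. unfold ctheta, zc, mcoef.
    rewrite INR_IZR_INZ, <- !RtoC_mult, <- !RtoC_plus, <- RtoC_mult. f_equal.
    rewrite <- !mult_IZR, <- plus_IZR, <- mult_IZR. f_equal. ring.
Qed.

Lemma halphen_VW (x : C) : (Cmod x < 1)%R ->
  RtoC 8 * (CPS (zc vcoef) x * CPS (zc wcoef) x) =
  CPS (ctheta (zc vcoef)) x - CPS (zc vcoef) x - CPS (ctheta (zc wcoef)) x.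
Proof.
  intros Hx.
  rewrite <- (CPS_zc_mult _ _ (fun n => ctheta (zc vcoef) n +
    RtoC (-1) * (zc vcoef n + ctheta (zc wcoef) n))); try disc.
  - rewrite CPS_plus, CPS_scal, CPS_plus by disc. ring.
  - intros n. rewrite vcoef_wcoef_convolution. unfold ctheta, zc.
    rewrite INR_IZR_INZ, <- !RtoC_mult, <- !RtoC_plus, <- RtoC_mult, <- RtoC_plus. f_equal.
    rewrite <- !mult_IZR, <- plus_IZR, <- mult_IZR, <- plus_IZR. f_equal. ring.
Qed.

Lemma halphen_MW (x : C) : (Cmod x < 1)%R ->
  RtoC 8 * (CPS (zc mcoef) x * CPS (zc wcoef) x) =
  CPS (ctheta (zc mcoef)) x - CPS (zc mcoef) x - CPS (ctheta (zc wcoef)) x.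
Proof.
  intros Hx.
  rewrite <- (CPS_zc_mult _ _ (fun n => ctheta (zc mcoef) n +
    RtoC (-1) * (zc mcoef n + ctheta (zc wcoef) n))); try disc.
  - rewrite CPS_plus, CPS_scal, CPS_plus by disc. ring.
  - intros n. unfold mcoef. rewrite sgn_vcoef_wcoef_convolution. unfold ctheta, zc, mcoef.
    rewrite INR_IZR_INZ, <- !RtoC_mult, <- !RtoC_plus, <- RtoC_mult, <- RtoC_plus. f_equal.
    rewrite <- !mult_IZR, <- plus_IZR, <- mult_IZR, <- plus_IZR. f_equal. ring.
Qed.

Lemma CPS_wcoef (x : C) : (Cmod x < 1)%R ->
  CPS (zc wcoef) x = CPS (zc vcoef) x + CPS (zc mcoef) x - RtoC 3 * CPS (zc scoef) x.
Proof.
  intros Hx.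
  transitivity (CPS (fun n => (zc vcoef n + zc mcoef n) + RtoC (-3) * zc scoef n) x).
  - apply CPS_ext. intros n. unfold zc, mcoef. rewrite wcoef_vcoef_scoef.
    rewrite <- !RtoC_mult, <- !RtoC_plus. f_equal.
    rewrite <- !mult_IZR, <- !plus_IZR. f_equal. ring.
  - rewrite CPS_plus, CPS_plus, CPS_scal by disc.
    replace (RtoC (-3)) with (- RtoC 3) by (rewrite <- RtoC_opp; reflexivity). ring.
Qed.

(** * Non-vanishing of the differences of the roots *)

(** [k 0 = 0] allows division by [x], which turns the equation for [x d/dx] into a regular one with
    coefficient [cshift k]. *)
Lemma CPS_theta_nonzero (a k : nat -> C) : disc_summable a -> disc_summable k ->
  a 0%nat <> 0 -> k 0%nat = 0 ->
  (forall x : C, x <> 0 -> (Cmod x < 1)%R -> CPS (ctheta a) x = CPS k x * CPS a x) ->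
  forall x : C, (Cmod x < 1)%R -> CPS a x <> 0.
Proof.
  intros Ha Hk Ha0 Hk0 H. apply (CPS_nonzero a (cshift k)); auto.
  - now apply disc_summable_cshift.
  - intros x Nx Hx. specialize (H x Nx Hx). unfold ctheta in H.
    rewrite CPS_theta in H by assumption. rewrite (CPS_decr k x Hk Hx), Hk0 in H.
    transitivity (/ x * (x * CPS (cdiff a) x)); [field; assumption|]. rewrite H. field. assumption.
Qed.

(** The difference [u = V - M] satisfies [x u' = (1 + 8 W) u]. The constant [1] is the order of
    vanishing of [u] at [0]: after division by [x] the leading coefficient is [2] and the equation
    becomes [x f' = 8 W f]. *)
Lemma V_minus_M_nonzero (x : C) : x <> 0 -> (Cmod x < 1)%R ->
  CPS (zc vcoef) x - CPS (zc mcoef) x <> 0.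
Proof.
  intros Nx Hx.
  set (u := fun n => zc vcoef n + RtoC (-1) * zc mcoef n).
  assert (Hu : disc_summable u) by (unfold u; disc).
  assert (Eu : forall y : C, (Cmod y < 1)%R -> CPS u y = CPS (zc vcoef) y - CPS (zc mcoef) y).
  { intros y Hy. unfold u. rewrite CPS_plus, CPS_scal by disc. ring. }
  assert (Etu : forall y : C, (Cmod y < 1)%R -> CPS (ctheta u) y =
    CPS (ctheta (zc vcoef)) y - CPS (ctheta (zc mcoef)) y).
  { intros y Hy. transitivity (CPS (fun n => ctheta (zc vcoef) n + RtoC (-1) * ctheta (zc mcoef) n) y).
    - apply CPS_ext. intros n. unfold u, ctheta. ring.
    - rewrite CPS_plus, CPS_scal by disc. ring. }
  assert (Hu0 : u 0%nat = 0).
  { unfold u, zc, mcoef. cbn. ring. }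
  assert (Hdecr : forall y : C, (Cmod y < 1)%R -> CPS u y = y * CPS (cshift u) y).
  { intros y Hy. rewrite CPS_decr, Hu0 by assumption. ring. }
  rewrite <- Eu, Hdecr by assumption. apply Cmult_neq_0; [assumption|].
  apply (CPS_theta_nonzero (cshift u) (fun n => RtoC 8 * zc wcoef n)); try disc; try assumption.
  - unfold cshift, u, zc. replace (vcoef 1) with 1%Z by reflexivity.
    replace (mcoef 1) with (-1)%Z by reflexivity. intros E.
    rewrite <- RtoC_mult, <- RtoC_plus in E. apply RtoC_inj in E. lra.
  - unfold zc. cbn. ring.
  - clear x Nx Hx. intros x Nx Hx. rewrite CPS_scal by disc.
    assert (Ht : CPS (ctheta u) x = x * (CPS (cshift u) x + CPS (ctheta (cshift u)) x)).
    { rewrite CPS_decr; [|now apply disc_summable_ctheta|assumption].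
      rewrite <- CPS_plus; [|disc|disc|assumption].
      unfold ctheta at 1. rewrite Hu0, Cmult_0_r, Cplus_0_l. f_equal. apply CPS_ext.
      intros n. unfold cshift, ctheta. rewrite S_INR, RtoC_plus. ring. }
    assert (E : CPS (ctheta u) x = CPS u x * (1 + RtoC 8 * CPS (zc wcoef) x)).
    { rewrite Etu, Eu by assumption.
      pose proof (halphen_VW x Hx) as H1. pose proof (halphen_MW x Hx) as H2.
      transitivity (CPS (zc vcoef) x - CPS (zc mcoef) x +
        (RtoC 8 * (CPS (zc vcoef) x * CPS (zc wcoef) x) - RtoC 8 * (CPS (zc mcoef) x * CPS (zc wcoef) x)));
      [rewrite H1, H2; ring|ring]. }
    rewrite Hdecr, Ht in E by assumption.
    transitivity (/ x * (x * (CPS (cshift u) x + CPS (ctheta (cshift u)) x)) - CPS (cshift u) x);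
      [field; assumption|]. rewrite E. field. assumption.
Qed.

Definition delta0 (n : nat) : C := match n with O => 1 | S _ => 0 end.

Lemma disc_delta0 : disc_summable delta0.
Proof.
  apply (disc_summable_le _ (fun _ => 1%R)).
  - intros [|n]; simpl; [rewrite Cmod_1|rewrite Cmod_0]; lra.
  - intros r Hr. eapply ex_series_ext; [|apply (ex_series_geom r)].
    + intros n. simpl. ring.
    + rewrite Rabs_pos_eq; lra.
Qed.

Lemma CPS_delta0 (x : C) : (Cmod x < 1)%R -> CPS delta0 x = 1.
Proof.
  intros Hx. rewrite CPS_decr by (apply disc_delta0 || assumption).
  rewrite (CPS_ext (cshift delta0) (fun n => 0 * delta0 n)), CPS_scal;
    [|apply disc_delta0|assumption|intros n; unfold cshift; simpl; ring].
  simpl. ring.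
Qed.

(** Up to the factor [pi i / 2] this is the difference of a root and the third root; its series
    starts with [1]. The pair [f], [g] stands for [V], [M] in either order. *)
Lemma one_plus_nonzero (f g : nat -> Z) :
  disc_summable (zc f) -> disc_summable (zc g) -> f 0%nat = 0%Z -> g 0%nat = 0%Z ->
  (forall x : C, (Cmod x < 1)%R ->
     CPS (ctheta (zc f)) x + CPS (ctheta (zc wcoef)) x =
     - (CPS (zc g) x * (1 + RtoC 8 * (CPS (zc f) x + CPS (zc wcoef) x)))) ->
  forall x : C, (Cmod x < 1)%R -> 1 + RtoC 8 * (CPS (zc f) x + CPS (zc wcoef) x) <> 0.
Proof.
  intros Hf Hg Hf0 Hg0 H x Hx.
  set (a := fun n => delta0 n + RtoC 8 * (zc f n + zc wcoef n)).
  assert (Ha : disc_summable a) by (pose proof disc_delta0; unfold a; disc).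
  assert (Ea : forall y : C, (Cmod y < 1)%R ->
    CPS a y = 1 + RtoC 8 * (CPS (zc f) y + CPS (zc wcoef) y)).
  { intros y Hy. unfold a.
    pose proof disc_delta0. rewrite CPS_plus, CPS_scal, CPS_plus, CPS_delta0 by disc. reflexivity. }
  rewrite <- Ea by assumption.
  apply (CPS_theta_nonzero a (fun n => RtoC (-8) * zc g n)); auto.
  - now apply disc_summable_scal.
  - unfold a, zc. rewrite Hf0. cbn. intros E.
    rewrite <- RtoC_plus, <- RtoC_mult, <- RtoC_plus in E. apply RtoC_inj in E. lra.
  - unfold zc. rewrite Hg0. ring.
  - intros y _ Hy. rewrite CPS_scal, Ea by assumption.
    transitivity (CPS (fun n => RtoC 8 * (ctheta (zc f) n + ctheta (zc wcoef) n)) y).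
    + apply CPS_ext. intros [|n]; unfold ctheta, a, delta0; simpl INR; ring.
    + rewrite CPS_scal, CPS_plus, H by disc. replace (RtoC (-8)) with (- RtoC 8) by (rewrite <- RtoC_opp; reflexivity). ring.
Qed.

Lemma V_plus_W_nonzero (x : C) : (Cmod x < 1)%R ->
  1 + RtoC 8 * (CPS (zc vcoef) x + CPS (zc wcoef) x) <> 0.
Proof.
  apply (one_plus_nonzero vcoef mcoef disc_vcoef disc_mcoef); [reflexivity|reflexivity|].
  clear x. intros x Hx.
  pose proof (halphen_VM x Hx) as H1. pose proof (halphen_MW x Hx) as H2.
  transitivity (- CPS (zc mcoef) x - RtoC 8 * (CPS (zc vcoef) x * CPS (zc mcoef) x)
    - RtoC 8 * (CPS (zc mcoef) x * CPS (zc wcoef) x)); [rewrite H1, H2; ring|ring].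
Qed.

Lemma M_plus_W_nonzero (x : C) : (Cmod x < 1)%R ->
  1 + RtoC 8 * (CPS (zc mcoef) x + CPS (zc wcoef) x) <> 0.
Proof.
  apply (one_plus_nonzero mcoef vcoef disc_mcoef disc_vcoef); [reflexivity|reflexivity|].
  clear x. intros x Hx.
  pose proof (halphen_VM x Hx) as H1. pose proof (halphen_VW x Hx) as H2.
  transitivity (- CPS (zc vcoef) x - RtoC 8 * (CPS (zc vcoef) x * CPS (zc mcoef) x)
    - RtoC 8 * (CPS (zc vcoef) x * CPS (zc wcoef) x)); [rewrite H1, H2; ring|ring].
Qed.

(** * Complex derivatives, the roots, and the derivatives of [gamma] *)

Notation is_cderive f z l := (is_derive (K := C_AbsRing) (V := C_NormedModule) f z l).

Lemma cderiv_eq (f : C -> C) (z l : C) : is_cderive f z l -> cderiv f z = l.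
Proof.
  intros H. unfold cderiv.
  assert (H' := epsilon_spec (inhabits (RtoC 0)) (fun l => is_cderive f z l) (ex_intro _ l H)).
  cbv beta in H'. rewrite <- (is_C_derive_unique _ _ _ H). symmetry. now apply is_C_derive_unique.
Qed.

Lemma is_cderive_plus (f g : C -> C) (z df dg : C) :
  is_cderive f z df -> is_cderive g z dg -> is_cderive (fun t => f t + g t) z (df + dg).
Proof. intros Hf Hg. exact (is_derive_plus (V := C_NormedModule) f g z df dg Hf Hg). Qed.

Lemma is_cderive_opp (f : C -> C) (z df : C) :
  is_cderive f z df -> is_cderive (fun t => - f t) z (- df).
Proof. intros Hf. exact (is_derive_opp (V := C_NormedModule) f z df Hf). Qed.

Lemma is_cderive_minus (f g : C -> C) (z df dg : C) :
  is_cderive f z df -> is_cderive g z dg -> is_cderive (fun t => f t - g t) z (df - dg).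
Proof. intros Hf Hg. exact (is_derive_minus (V := C_NormedModule) f g z df dg Hf Hg). Qed.

Lemma is_cderive_mult (f g : C -> C) (z df dg : C) :
  is_cderive f z df -> is_cderive g z dg ->
  is_cderive (fun t => f t * g t) z (df * g z + f z * dg).
Proof.
  intros Hf Hg. apply is_derive_C_AbsRing.
  apply (is_derive_mult (K := C_AbsRing) f g); [now apply is_derive_C_AbsRing..|exact Cmult_comm].
Qed.

Lemma is_cderive_const (c z : C) : is_cderive (fun _ => c) z (RtoC 0).
Proof. exact (is_derive_const (V := C_NormedModule) c z). Qed.

Lemma is_cderive_id (z : C) : is_cderive (fun t => t) z (RtoC 1).
Proof. apply is_derive_C_AbsRing. exact (is_derive_id z). Qed.

Lemma is_cderive_eq (f : C -> C) (z l l' : C) : is_cderive f z l -> l = l' -> is_cderive f z l'.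
Proof. now intros H <-. Qed.

Ltac cderive :=
  lazymatch goal with
  | |- is_derive (fun s => s) _ _ => apply is_cderive_id
  | |- is_derive (fun s => @?f s + @?g s) _ _ => apply (is_cderive_plus f g); cbv beta; cderive
  | |- is_derive (fun s => @?f s - @?g s) _ _ => apply (is_cderive_minus f g); cbv beta; cderive
  | |- is_derive (fun s => - @?f s) _ _ => apply (is_cderive_opp f); cbv beta; cderive
  | |- is_derive (fun s => @?f s * @?g s) _ _ => apply (is_cderive_mult f g); cbv beta; cderive
  | |- is_derive (fun s => @?f s / ?c) _ _ =>
      apply (is_cderive_mult f (fun _ => / c)); cbv beta; cderive
  | |- _ => first [eassumption | apply is_cderive_const]
  end.

Lemma locally_in_H (tau : C) : in_H tau -> locally (T := AbsRing_UniformSpace C_AbsRing) tau in_H.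
Proof.
  unfold in_H. intros H. exists (mkposreal _ H). intros y Hy.
  change (Cmod (y - tau) < Im tau)%R in Hy. pose proof (Rabs_Im_le (y - tau)) as Hi.
  pose proof (Rle_abs (- Im (y - tau))) as Ha. rewrite Rabs_Ropp in Ha.
  unfold Im in *. simpl in *. lra.
Qed.

(** Openness of the half-plane lets formulas valid only there be differentiated, in particular those
    for [gamma] and [cderiv gamma]. *)
Lemma is_cderive_ext_H (f g : C -> C) (tau l : C) : in_H tau ->
  (forall s, in_H s -> f s = g s) -> is_cderive f tau l -> is_cderive g tau l.
Proof.
  intros H E. apply is_derive_ext_loc. generalize (locally_in_H tau H).
  apply filter_imp. exact E.
Qed.

(** Classically these are [-2] times the logarithmic [tau]-derivatives of the theta constants
    [theta_4], [theta_3], [theta_2]; the term [- pi i / 2] comes from the factor [x^(1/4)] of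
    [theta_2]. *)
Definition Nroot (i : nat) (tau : C) : C :=
  match i with
  | 0%nat => RtoC 4 * pii * CPS (zc vcoef) (nome tau)
  | 1%nat => RtoC 4 * pii * CPS (zc mcoef) (nome tau)
  | _ => - (pii / RtoC 2) - RtoC 4 * pii * CPS (zc wcoef) (nome tau)
  end.

(** The Halphen equations solved for one derivative: [2 N_i' = (N_i + N_j)' + (N_i + N_k)' - (N_j +
    N_k)']. *)
Lemma Nroot_derive (i : nat) (tau : C) : (i < 3)%nat -> in_H tau ->
  is_cderive (Nroot i) tau
    (Nroot (nxt i) tau * Nroot (nxt2 i) tau - Nroot i tau * (Nroot (nxt i) tau + Nroot (nxt2 i) tau)).
Proof.
  intros Hi Ht. pose proof (Cmod_nome tau Ht) as Hx.
  pose proof (is_derive_CPS_nome _ _ disc_vcoef Ht) as DV.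
  pose proof (is_derive_CPS_nome _ _ disc_mcoef Ht) as DM.
  pose proof (is_derive_CPS_nome _ _ disc_wcoef Ht) as DW.
  pose proof (halphen_VM _ Hx) as H1. pose proof (halphen_VW _ Hx) as H2.
  pose proof (halphen_MW _ Hx) as H3.
  set (v := CPS (zc vcoef) (nome tau)) in *. set (m := CPS (zc mcoef) (nome tau)) in *.
  set (w := CPS (zc wcoef) (nome tau)) in *.
  set (v' := CPS (ctheta (zc vcoef)) (nome tau)) in *.
  set (m' := CPS (ctheta (zc mcoef)) (nome tau)) in *.
  set (w' := CPS (ctheta (zc wcoef)) (nome tau)) in *.
  assert (Ev : RtoC 2 * v' = v - RtoC 8 * (v * m) + RtoC 8 * (v * w) - m - RtoC 8 * (m * w))
    by (rewrite H1, H2, H3; ring).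
  assert (Em : RtoC 2 * m' = m - RtoC 8 * (v * m) + RtoC 8 * (m * w) - v - RtoC 8 * (v * w))
    by (rewrite H1, H2, H3; ring).
  assert (Ew : RtoC 2 * w' = - (RtoC 8 * (v * m)) - RtoC 8 * (v * w) - RtoC 8 * (m * w) - v - m)
    by (rewrite H1, H2, H3; ring).
  destruct i as [|[|[|i]]]; [| | |lia]; unfold Nroot, nxt, nxt2; cbn [Nat.modulo Nat.divmod Nat.sub fst snd];
    fold v m w;
    (eapply is_cderive_eq; [cderive|]).
  - transitivity (RtoC 2 * pii * pii * (RtoC 2 * v')); [ring|rewrite Ev; field].
  - transitivity (RtoC 2 * pii * pii * (RtoC 2 * m')); [ring|rewrite Em; field].
  - transitivity (- (RtoC 2 * pii * pii * (RtoC 2 * w'))); [ring|rewrite Ew; field].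
Qed.

Lemma pii_neq_0 : pii <> 0.
Proof.
  unfold pii. apply Cmult_neq_0.
  - intros E. apply RtoC_inj in E. pose proof PI_RGT_0. lra.
  - intros E. apply (f_equal snd) in E. simpl in E. lra.
Qed.

Lemma Nroot_distinct (tau : C) : in_H tau ->
  Nroot 0 tau <> Nroot 1 tau /\ Nroot 0 tau <> Nroot 2 tau /\ Nroot 1 tau <> Nroot 2 tau.
Proof.
  intros Ht. pose proof (Cmod_nome tau Ht) as Hx. pose proof pii_neq_0 as Hp.
  pose proof (V_minus_M_nonzero _ (nome_neq_0 tau) Hx) as H1.
  pose proof (V_plus_W_nonzero _ Hx) as H2. pose proof (M_plus_W_nonzero _ Hx) as H3.
  unfold Nroot.
  set (v := CPS (zc vcoef) (nome tau)) in *. set (m := CPS (zc mcoef) (nome tau)) in *.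
  set (w := CPS (zc wcoef) (nome tau)) in *.
  assert (K : forall d e : C, d <> 0 -> pii * d = e -> e <> 0).
  { intros d e Hd <-. now apply Cmult_neq_0. }
  assert (H4 : RtoC 4 <> 0) by (intros E; apply RtoC_inj in E; lra).
  assert (H12 : / RtoC 2 <> 0).
  { rewrite <- RtoC_inv by lra. intros E; apply RtoC_inj in E; lra. }
  assert (S : forall a b : C, a - b <> 0 -> a <> b) by (intros a b Hab ->; apply Hab; ring).
  repeat split; apply S.
  - apply (K (RtoC 4 * (v - m))); [now apply Cmult_neq_0|ring].
  - apply (K (/ RtoC 2 * (1 + RtoC 8 * (v + w)))); [now apply Cmult_neq_0|field].
  - apply (K (/ RtoC 2 * (1 + RtoC 8 * (m + w)))); [now apply Cmult_neq_0|field].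
Qed.

Lemma csum_eq (a : nat -> C) (l : C) :
  is_series (K := C_AbsRing) (V := C_NormedModule) a l -> csum a = l.
Proof.
  intros H. unfold csum.
  assert (H' := epsilon_spec (inhabits (RtoC 0))
    (fun l => is_series (K := C_AbsRing) (V := C_NormedModule) a l) (ex_intro _ l H)).
  cbv beta in H'. exact (is_series_C_unique _ _ _ H' H).
Qed.

(** The coefficients of odd index and of index [0] vanish, so the partial sum up to [q^(n+1)] is the
    one up to [x^(2n+2)]: a subsequence of a convergent sequence. *)
Lemma sigma1_series (tau : C) : in_H tau ->
  csum (fun n => RtoC (INR (sigma1 (S n))) * Cpow (qnome tau) (S n)) =
  CPS (zc scoef) (nome tau).
Proof.
  intros Ht. apply csum_eq. pose proof (Cmod_nome tau Ht) as Hx.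
  pose proof (is_series_CPS _ _ disc_scoef Hx) as H. unfold is_series in *.
  assert (Lim : filterlim (fun n => (2 * n + 2)%nat) eventually eventually).
  { apply eventually_subseq. intros n. lia. }
  pose proof (filterlim_comp _ _ _ _ _ _ _ _ Lim H) as H'.
  eapply filterlim_ext; [|exact H']. intros n. cbv beta.
  assert (Ev : forall m, zc scoef (2 * m) * Cpow (nome tau) (2 * m) =
    RtoC (INR (sigma1 m)) * Cpow (qnome tau) m).
  { intros m. unfold zc. rewrite scoef_even, <- INR_IZR_INZ. f_equal.
    rewrite Cpow_mult_r, qnome_nome. f_equal. simpl. ring. }
  assert (Od : forall m, zc scoef (2 * m + 1) * Cpow (nome tau) (2 * m + 1) = 0).
  { intros m. unfold zc. rewrite scoef_odd. ring. }
  induction n as [|n IH].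
  - change (2 * 0 + 2)%nat with 2%nat. rewrite !sum_Sn, !sum_O.
    pose proof (Ev 0%nat) as E0. pose proof (Ev 1%nat) as E1. pose proof (Od 0%nat) as E2.
    simpl (2 * 0)%nat in *. simpl (2 * 1)%nat in *. simpl (0 + 1)%nat in *.
    rewrite E0, E1, E2. change (sigma1 0) with 0%nat.
    change (RtoC (INR 0) * Cpow (qnome tau) 0 + 0 + RtoC (INR (sigma1 1)) * Cpow (qnome tau) 1 =
      RtoC (INR (sigma1 1)) * Cpow (qnome tau) 1). simpl INR. ring.
  - replace (2 * S n + 2)%nat with (S (S (2 * n + 2))) by lia.
    rewrite !sum_Sn. rewrite IH.
    replace (S (2 * n + 2)) with (2 * (S n) + 1)%nat by lia. rewrite Od.
    replace (S (2 * S n + 1)) with (2 * (S (S n)))%nat by lia. rewrite Ev.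
    f_equal. apply Cplus_0_r.
Qed.

(** Since [V + M - W = 3 S], the roots add up to [- pi i / 2 (1 - 24 S)], which is [- pi i / 2]
    times [E2]. *)
Lemma gamma_Nroot (tau : C) : in_H tau ->
  gamma tau = - (RtoC 2 / RtoC 3) * (Nroot 0 tau + Nroot 1 tau + Nroot 2 tau).
Proof.
  intros Ht. unfold gamma, E2. rewrite sigma1_series by assumption. unfold Nroot.
  rewrite (CPS_wcoef _ (Cmod_nome tau Ht)). fold pii. field.
Qed.

Definition Ndot (i : nat) (tau : C) : C :=
  Nroot (nxt i) tau * Nroot (nxt2 i) tau - Nroot i tau * (Nroot (nxt i) tau + Nroot (nxt2 i) tau).

Definition gamma1 (tau : C) : C := RtoC 2 / RtoC 3 *
  (Nroot 0 tau * Nroot 1 tau + Nroot 0 tau * Nroot 2 tau + Nroot 1 tau * Nroot 2 tau).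

Definition gamma2 (tau : C) : C := - RtoC 4 * (Nroot 0 tau * Nroot 1 tau * Nroot 2 tau).

(** Expanding [Ndot] gives [16 e_1 e_3 - 4 e_2^2], which is [6 gamma gamma'' - 9 gamma'^2]; this is
    how the equation of [gamma] is present. *)
Definition gamma3 (tau : C) : C := - RtoC 4 *
  (Ndot 0 tau * Nroot 1 tau * Nroot 2 tau + Nroot 0 tau * Ndot 1 tau * Nroot 2 tau
   + Nroot 0 tau * Nroot 1 tau * Ndot 2 tau).

(** The Halphen system gives [e_1' = - e_2] and [e_2' = - 6 e_3]. *)
Lemma gamma_derives (tau : C) : in_H tau ->
  is_cderive gamma tau (gamma1 tau) /\ is_cderive gamma1 tau (gamma2 tau) /\
  is_cderive gamma2 tau (gamma3 tau).
Proof.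
  intros Ht.
  pose proof (Nroot_derive 0 tau ltac:(lia) Ht) as D0.
  pose proof (Nroot_derive 1 tau ltac:(lia) Ht) as D1.
  pose proof (Nroot_derive 2 tau ltac:(lia) Ht) as D2.
  cbn [nxt nxt2 Nat.modulo Nat.divmod Nat.sub fst snd] in D0, D1, D2.
  split; [|split].
  - apply (is_cderive_ext_H (fun t => - (RtoC 2 / RtoC 3) * (Nroot 0 t + Nroot 1 t + Nroot 2 t)));
      [assumption|intros s Hs; symmetry; now apply gamma_Nroot|].
    eapply is_cderive_eq; [cderive|]. unfold gamma1. unfold nxt, nxt2. cbn [Nat.modulo Nat.divmod Nat.sub fst snd]. field.
  - unfold gamma1, gamma2. eapply is_cderive_eq; [cderive|].
    unfold nxt, nxt2. cbn [Nat.modulo Nat.divmod Nat.sub fst snd]. field.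
  - unfold gamma2, gamma3. eapply is_cderive_eq; [cderive|].
    unfold Ndot, nxt, nxt2. cbn [Nat.modulo Nat.divmod Nat.sub fst snd]. ring.
Qed.

Lemma cderiv_gamma (tau : C) : in_H tau -> cderiv gamma tau = gamma1 tau.
Proof. intros H. apply cderiv_eq, gamma_derives, H. Qed.

Lemma cderiv2_gamma (tau : C) : in_H tau -> cderiv (cderiv gamma) tau = gamma2 tau.
Proof.
  intros H. apply cderiv_eq. apply (is_cderive_ext_H gamma1); [assumption| |].
  - intros s Hs. symmetry. now apply cderiv_gamma.
  - now apply gamma_derives.
Qed.

Lemma Cmult_eq_0 (a b : C) : a * b = 0 -> a = 0 \/ b = 0.
Proof.
  intros E. destruct (Ceq_dec a 0) as [Ha|Ha]; [now left|].
  destruct (Ceq_dec b 0) as [Hb|Hb]; [now right|]. now destruct (Cmult_neq_0 a b).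
Qed.

Lemma three_roots (a b c x : C) :
  (a - x) * (b - x) * (c - x) = 0 <-> (x = a \/ x = b \/ x = c).
Proof.
  split.
  - intros E. assert (K : forall d : C, d - x = 0 -> x = d).
    { intros d Hd. transitivity (x + (d - x)); [rewrite Hd|]; ring. }
    apply Cmult_eq_0 in E. destruct E as [E|E]; [apply Cmult_eq_0 in E; destruct E as [E|E]|]; auto.
  - intros [->|[->| ->]]; ring.
Qed.

Lemma Nroot_cubic (tau x : C) : in_H tau ->
  Cpow x 3 + RtoC (3 / 2) * gamma tau * Cpow x 2 + RtoC (3 / 2) * cderiv gamma tau * x
    + / RtoC 4 * cderiv (cderiv gamma) tau = 0
  <-> (x = Nroot 0 tau \/ x = Nroot 1 tau \/ x = Nroot 2 tau).
Proof.
  intros Ht. rewrite cderiv2_gamma, cderiv_gamma, gamma_Nroot by assumption.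
  rewrite <- three_roots. unfold gamma1, gamma2.
  set (a := Nroot 0 tau). set (b := Nroot 1 tau). set (c := Nroot 2 tau).
  rewrite RtoC_div by lra.
  match goal with |- ?l = RtoC 0 <-> ?r = RtoC 0 => assert (E : l = - r) by (simpl Cpow; field) end.
  rewrite E. split; intros H.
  - transitivity (- - ((a - x) * (b - x) * (c - x))); [ring|rewrite H; ring].
  - rewrite H. ring.
Qed.

(** * The Frobenius structure *)

(** Iterated [pd] is evaluated from the inside out, each inner value being known only over the
    half-plane. Moving the third coordinate needs its openness; moving another one stays over the
    same [tau]. *)
Lemma pd_eq (f g : pt -> C) (j : nat) (t : pt) (l : C) :
  (forall s, in_H (s 2%nat) -> f s = g s) -> in_H (t 2%nat) ->
  is_cderive (fun s => g (upd t j s)) (t j) l -> pd j f t = l.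
Proof.
  intros E Ht D. apply cderiv_eq.
  destruct (Nat.eq_dec j 2) as [->|Hj].
  - apply (is_cderive_ext_H (fun s => g (upd t 2 s))); [assumption| |assumption].
    intros s Hs. symmetry. apply E. exact Hs.
  - eapply is_derive_ext; [|exact D]. intros s. symmetry. apply E.
    unfold upd. destruct (Nat.eqb_spec 2 j); [congruence|exact Ht].
Qed.

(** Powers are spelled out as products, the shape that [cderive] differentiates; likewise in the
    next two tables. *)
Definition dF (k : nat) (t : pt) : C :=
  match k with
  | 0%nat => t 0%nat * t 2%nat + / RtoC 2 * (t 1%nat * t 1%nat)
  | 1%nat => t 0%nat * t 1%nat - / RtoC 4 * (t 1%nat * t 1%nat * t 1%nat) * gamma (t 2%nat)
  | _ => / RtoC 2 * (t 0%nat * t 0%nat)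
         - / RtoC 16 * (t 1%nat * t 1%nat * t 1%nat * t 1%nat) * gamma1 (t 2%nat)
  end.

Definition ddF (j k : nat) (t : pt) : C :=
  match j, k with
  | 0%nat, 0%nat => t 2%nat
  | 0%nat, 1%nat | 1%nat, 0%nat => t 1%nat
  | 0%nat, _ | _, 0%nat => t 0%nat
  | 1%nat, 1%nat => t 0%nat - RtoC 3 / RtoC 4 * (t 1%nat * t 1%nat) * gamma (t 2%nat)
  | 1%nat, _ | _, 1%nat => - / RtoC 4 * (t 1%nat * t 1%nat * t 1%nat) * gamma1 (t 2%nat)
  | _, _ => - / RtoC 16 * (t 1%nat * t 1%nat * t 1%nat * t 1%nat) * gamma2 (t 2%nat)
  end.

Definition dddF (i j k : nat) (t : pt) : C :=
  match i, j, k with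
  | 0%nat, 0%nat, 2%nat | 0%nat, 2%nat, 0%nat | 2%nat, 0%nat, 0%nat | 0%nat, 1%nat, 1%nat | 1%nat, 0%nat, 1%nat | 1%nat, 1%nat, 0%nat => 1
  | 0%nat, _, _ | _, 0%nat, _ | _, _, 0%nat => 0
  | 1%nat, 1%nat, 1%nat => - (RtoC 3 / RtoC 2) * t 1%nat * gamma (t 2%nat)
  | 1%nat, 1%nat, _ | 1%nat, _, 1%nat | _, 1%nat, 1%nat => - (RtoC 3 / RtoC 4) * (t 1%nat * t 1%nat) * gamma1 (t 2%nat)
  | 1%nat, _, _ | _, 1%nat, _ | _, _, 1%nat =>
      - / RtoC 4 * (t 1%nat * t 1%nat * t 1%nat) * gamma2 (t 2%nat)
  | _, _, _ => - / RtoC 16 * (t 1%nat * t 1%nat * t 1%nat * t 1%nat) * gamma3 (t 2%nat)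
  end.

Ltac pd_table Ht :=
  let D0 := fresh in let D1 := fresh in let D2 := fresh in
  destruct (gamma_derives _ Ht) as (D0 & D1 & D2);
  cbn [Fpot dF ddF dddF upd Nat.eqb];
  eapply is_cderive_eq; [cderive|field].

Lemma pd_Fpot (k : nat) (t : pt) : (k < 3)%nat -> in_H (t 2%nat) -> pd k Fpot t = dF k t.
Proof.
  intros Hk Ht. apply (pd_eq _ (fun t => / RtoC 2 * t 0%nat * t 0%nat * t 2%nat + / RtoC 2 * t 0%nat * t 1%nat * t 1%nat
    - t 1%nat * t 1%nat * t 1%nat * t 1%nat / RtoC 16 * gamma (t 2%nat))); [|assumption|].
  - intros s _. unfold Fpot. simpl Cpow. field.
  - destruct k as [|[|[|k]]]; [| | |lia]; pd_table Ht.
Qed.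

Lemma pd2_Fpot (j k : nat) (t : pt) : (j < 3)%nat -> (k < 3)%nat -> in_H (t 2%nat) ->
  pd j (pd k Fpot) t = ddF j k t.
Proof.
  intros Hj Hk Ht. apply (pd_eq _ (dF k)); [intros; now apply pd_Fpot|assumption|].
  destruct k as [|[|[|k]]]; [| | |lia]; (destruct j as [|[|[|j]]]; [| | |lia]); pd_table Ht.
Qed.

Lemma C3_eq (i j k : nat) (t : pt) : (i < 3)%nat -> (j < 3)%nat -> (k < 3)%nat ->
  in_H (t 2%nat) -> C3 i j k t = dddF i j k t.
Proof.
  intros Hi Hj Hk Ht. apply (pd_eq _ (ddF j k)); [intros; now apply pd2_Fpot|assumption|].
  destruct k as [|[|[|k]]]; [| | |lia]; (destruct j as [|[|[|j]]]; [| | |lia]);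
  (destruct i as [|[|[|i]]]; [| | |lia]); pd_table Ht.
Qed.

(** The antidiagonal matrix is its own inverse, so it serves for [eta] and [etainv]; raising an
    index replaces [i] by [2 - i]. *)
Definition eta0 (i j : nat) : C := if (i + j =? 2)%nat then 1 else 0.

Lemma eta_eq (t : pt) (i j : nat) : in_H (t 2%nat) -> (i < 3)%nat -> (j < 3)%nat ->
  eta t i j = eta0 i j.
Proof.
  intros Ht Hi Hj. unfold eta. rewrite C3_eq by (lia || assumption).
  destruct i as [|[|[|i]]]; [| | |lia]; (destruct j as [|[|[|j]]]; [| | |lia]); reflexivity.
Qed.

Lemma inv3_ext (M M' : nat -> nat -> C) (i j : nat) :
  (forall k l, (k < 3)%nat -> (l < 3)%nat -> M k l = M' k l) -> inv3 M i j = inv3 M' i j.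
Proof.
  intros H. unfold inv3, cof3, det3.
  assert (Hn : forall n, (nxt n < 3)%nat /\ (nxt2 n < 3)%nat).
  { intros n. split; apply Nat.mod_upper_bound; discriminate. }
  rewrite !H by (lia || apply Hn). reflexivity.
Qed.

Lemma etainv_eq (t : pt) (i j : nat) : in_H (t 2%nat) -> (i < 3)%nat -> (j < 3)%nat ->
  etainv t i j = eta0 i j.
Proof.
  intros Ht Hi Hj. unfold etainv.
  rewrite (inv3_ext _ eta0) by (intros; now apply eta_eq).
  destruct i as [|[|[|i]]]; [| | |lia]; (destruct j as [|[|[|j]]]; [| | |lia]);
    unfold inv3, cof3, det3, eta0, nxt, nxt2;
    cbn [Nat.modulo Nat.divmod Nat.sub Nat.add Nat.eqb fst snd]; field;
    rewrite ?Cmult_0_l; intros E; apply (f_equal fst) in E; simpl in E; lra.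
Qed.

Lemma sum3_eta0 (i : nat) (f : nat -> C) : (i < 3)%nat ->
  sum3 (fun l => eta0 i l * f l) = f (2 - i)%nat.
Proof.
  intros Hi. unfold sum3, eta0.
  destruct i as [|[|[|i]]]; [| | |lia]; cbn [Nat.add Nat.eqb Nat.sub]; ring.
Qed.

Lemma sum3_ext (f g : nat -> C) : (forall l, (l < 3)%nat -> f l = g l) -> sum3 f = sum3 g.
Proof. intros H. unfold sum3. rewrite !H by lia. reflexivity. Qed.

Lemma Cstr_eq (t : pt) (i j k : nat) : in_H (t 2%nat) ->
  (i < 3)%nat -> (j < 3)%nat -> (k < 3)%nat -> Cstr t i j k = dddF (2 - k) i j t.
Proof.
  intros Ht Hi Hj Hk. unfold Cstr. rewrite <- (sum3_eta0 k (fun l => dddF l i j t)) by assumption.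
  apply sum3_ext. intros l Hl. rewrite etainv_eq, C3_eq by assumption. reflexivity.
Qed.

Lemma Cup_eq (t : pt) (k i j : nat) : in_H (t 2%nat) ->
  (i < 3)%nat -> (j < 3)%nat -> (k < 3)%nat -> Cup t k i j = dddF (2 - j) (2 - i) k t.
Proof.
  intros Ht Hi Hj Hk. unfold Cup.
  rewrite <- (sum3_eta0 i (fun l => dddF (2 - j) l k t)) by assumption.
  apply sum3_ext. intros l Hl. rewrite etainv_eq, Cstr_eq by assumption. reflexivity.
Qed.

Lemma gint_eq (t : pt) (i j : nat) : in_H (t 2%nat) -> (i < 3)%nat -> (j < 3)%nat ->
  gint t i j = t 0%nat * dddF (2 - j) (2 - i) 0 t + / RtoC 2 * t 1%nat * dddF (2 - j) (2 - i) 1 t.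
Proof.
  intros Ht Hi Hj. unfold gint, sum3, Euler. rewrite !Cup_eq by (lia || assumption). ring.
Qed.

(** With [x = t_1 + t_2^2 N / 2] the determinant becomes a multiple of the cubic in [N]. The overall
    sign is the determinant [-1] of the inverse metric times that of [(-1)^3] absorbed in the
    factors [u_i - x]. *)
Lemma det_gint (t : pt) (x : C) : in_H (t 2%nat) ->
  det3 (fun i j => gint t i j - x * etainv t i j) =
  - ((t 0%nat + / RtoC 2 * Cpow (t 1%nat) 2 * Nroot 0 (t 2%nat) - x) *
     (t 0%nat + / RtoC 2 * Cpow (t 1%nat) 2 * Nroot 1 (t 2%nat) - x) *
     (t 0%nat + / RtoC 2 * Cpow (t 1%nat) 2 * Nroot 2 (t 2%nat) - x)).
Proof.
  intros Ht. unfold det3. rewrite !gint_eq, !etainv_eq by (lia || assumption).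
  unfold eta0. cbn [Nat.add Nat.eqb Nat.sub dddF].
  rewrite gamma_Nroot by assumption. unfold gamma1, gamma2, gamma3.
  set (a := Nroot 0 _). set (b := Nroot 1 _). set (c := Nroot 2 _). simpl Cpow. field.
Qed.

Lemma jac_eq (t : pt) (i k : nat) : in_H (t 2%nat) -> (i < 3)%nat -> (k < 3)%nat ->
  jac (fun (i : nat) (s : pt) => s 0%nat + / RtoC 2 * Cpow (s 1%nat) 2 * Nroot i (s 2%nat)) t i k =
  match k with
  | 0%nat => 1
  | 1%nat => t 1%nat * Nroot i (t 2%nat)
  | _ => / RtoC 2 * (t 1%nat * t 1%nat) * Ndot i (t 2%nat)
  end.
Proof.
  intros Ht Hi Hk. unfold jac.
  apply (pd_eq _ (fun s => s 0%nat + / RtoC 2 * (s 1%nat * s 1%nat) * Nroot i (s 2%nat)));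
    [intros; simpl Cpow; ring|assumption|].
  pose proof (Nroot_derive i _ Hi Ht) as D. fold (Ndot i (t 2%nat)) in D.
  destruct k as [|[|[|k]]]; [| | |lia]; cbn [upd Nat.eqb]; (eapply is_cderive_eq; [cderive|field]).
Qed.

(* In canonical coordinates [d/du_i] is the gradient of [u_i] divided by its square norm;
   this gives the inverse Jacobian in closed form. *)
Definition gradN (t : pt) (i k : nat) : C :=
  match k with
  | 0%nat => / RtoC 2 * (t 1%nat * t 1%nat) * Ndot i (t 2%nat)
  | 1%nat => t 1%nat * Nroot i (t 2%nat)
  | _ => 1
  end.

(** The square norm is [t_2^2 (Ndot_i + N_i^2)], which factors because
    [Ndot_i = N_j N_k - N_i (N_j + N_k)]. *)
Definition normN (t : pt) (i : nat) : C :=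
  t 1%nat * t 1%nat * (Nroot i (t 2%nat) - Nroot (nxt i) (t 2%nat))
    * (Nroot i (t 2%nat) - Nroot (nxt2 i) (t 2%nat)).

(** After clearing the norms the claim says that the gradients multiply as [grad u_i o grad u_j =
    delta_ij |grad u_i|^2 grad u_i]. *)
Lemma canonical_Nroot (t : pt) : in_H (t 2%nat) -> t 1%nat <> 0 ->
  canonical_coords_at
    (fun (i : nat) (s : pt) => s 0%nat + / RtoC 2 * Cpow (s 1%nat) 2 * Nroot i (s 2%nat)) t.
Proof.
  intros Ht H1. destruct (Nroot_distinct _ Ht) as (N01 & N02 & N12).
  set (u := fun (i : nat) (s : pt) => s 0%nat + / RtoC 2 * Cpow (s 1%nat) 2 * Nroot i (s 2%nat)).
  assert (S : forall a b : C, a <> b -> a - b <> 0).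
  { intros a b Hab E. apply Hab. transitivity (a - b + b); [ring|rewrite E; ring]. }
  assert (S' : forall a b : C, a <> b -> b - a <> 0) by auto.
  set (J := fun i k : nat => match k return C with
    | 0%nat => 1
    | 1%nat => t 1%nat * Nroot i (t 2%nat)
    | _ => / RtoC 2 * (t 1%nat * t 1%nat) * Ndot i (t 2%nat)
    end).
  assert (HJ : forall i k, (i < 3)%nat -> (k < 3)%nat -> jac u t i k = J i k)
    by (intros; now apply jac_eq).
  (* As [Ndot_i = 2 N_i^2 - 2 e_1 N_i + e_2], column operations reduce [J] to a Vandermonde matrix
     in the [N_i]. *)
  assert (Hdet : det3 J = t 1%nat * t 1%nat * t 1%nat *
    ((Nroot 1 (t 2%nat) - Nroot 0 (t 2%nat)) * (Nroot 2 (t 2%nat) - Nroot 0 (t 2%nat))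
     * (Nroot 2 (t 2%nat) - Nroot 1 (t 2%nat)))).
  { unfold det3, J, Ndot, nxt, nxt2. cbn [Nat.modulo Nat.divmod Nat.sub fst snd]. field. }
  split.
  - assert (E : det3 (jac u t) = det3 J) by (unfold det3; rewrite !HJ by lia; reflexivity).
    rewrite E, Hdet. repeat apply Cmult_neq_0; auto.
  - assert (Hinv : forall k i, (k < 3)%nat -> (i < 3)%nat ->
      inv3 (jac u t) k i = gradN t i k / normN t i).
    { intros k i Hk Hi. rewrite (inv3_ext _ J) by auto. unfold inv3. rewrite Hdet.
      unfold cof3, J, gradN, normN, Ndot.
      destruct k as [|[|[|k]]]; [| | |lia]; (destruct i as [|[|[|i]]]; [| | |lia]);
        unfold nxt, nxt2; cbn [Nat.modulo Nat.divmod Nat.sub fst snd];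
        field; repeat split; auto. }
    intros i j m Hi Hj Hm. unfold prod_vec.
    assert (E : sum3 (fun k => sum3 (fun l => inv3 (jac u t) k i * inv3 (jac u t) l j * Cstr t k l m))
      = sum3 (fun k => sum3 (fun l => gradN t i k * gradN t j l * dddF (2 - m) k l t))
        / (normN t i * normN t j)).
    { assert (Hn : forall i, (i < 3)%nat -> normN t i <> 0).
      { intros n Hn. unfold normN. destruct n as [|[|[|n]]]; [| | |lia];
          cbn [nxt nxt2 Nat.modulo Nat.divmod Nat.sub fst snd]; repeat apply Cmult_neq_0; auto. }
      unfold sum3. rewrite !Hinv, !Cstr_eq by (lia || assumption). field. auto. }
    rewrite E. rewrite Hinv by assumption. clear E Hinv Hdet HJ.
    unfold sum3, gradN, normN, Ndot.
    destruct i as [|[|[|i]]]; [| | |lia]; (destruct j as [|[|[|j]]]; [| | |lia]);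
    (destruct m as [|[|[|m]]]; [| | |lia]);
    unfold nxt, nxt2; cbn [Nat.eqb Nat.modulo Nat.divmod Nat.sub fst snd dddF];
    rewrite ?gamma_Nroot by assumption; unfold gamma1, gamma2, gamma3, Ndot, nxt, nxt2;
    cbn [Nat.modulo Nat.divmod Nat.sub fst snd];
    field; repeat split; auto.
Qed.

Theorem mainTheorem5 :
  (* the metric: eta = dt2^2 + 2 dt1 dt3 on C^2 x H *)
  (forall t : pt, in_H (t 2%nat) ->
     forall i j : nat, (i < 3)%nat -> (j < 3)%nat ->
       eta t i j =
       (if ((i =? 1) && (j =? 1))%nat%bool then 1
        else if ((i =? 0) && (j =? 2) || (i =? 2) && (j =? 0))%nat%bool then 1
        else 0)) /\
  exists N : nat -> C -> C,
    (* N_1, N_2, N_3 holomorphic on H *)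
    (forall i tau, (i < 3)%nat -> in_H tau -> holo_at (N i) tau) /\
    (* for each tau, they are the three distinct roots of the cubic *)
    (forall tau, in_H tau ->
       N 0%nat tau <> N 1%nat tau /\ N 0%nat tau <> N 2%nat tau /\
       N 1%nat tau <> N 2%nat tau /\
       forall x : C,
         Cpow x 3 + RtoC (3/2) * gamma tau * Cpow x 2
         + RtoC (3/2) * cderiv gamma tau * x
         + / RtoC 4 * cderiv (cderiv gamma) tau = 0
         <-> (x = N 0%nat tau \/ x = N 1%nat tau \/ x = N 2%nat tau)) /\
    (* on C x C^* x H *)
    (forall t : pt, in_H (t 2%nat) -> t 1%nat <> 0 ->
       let u := fun (i : nat) (s : pt) =>
                  s 0%nat + / RtoC 2 * Cpow (s 1%nat) 2 * N i (s 2%nat) in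
       (* the roots of det(g^{ij}(t) - u eta^{ij}) = 0 are u_1, u_2, u_3 *)
       (forall x : C,
          det3 (fun i j => gint t i j - x * etainv t i j) = 0
          <-> (x = u 0%nat t \/ x = u 1%nat t \/ x = u 2%nat t)) /\
       (* pairwise distinct *)
       u 0%nat t <> u 1%nat t /\ u 0%nat t <> u 2%nat t /\ u 1%nat t <> u 2%nat t /\
       (* canonical coordinates *)
       canonical_coords_at u t).
Proof.
  split.
  - intros t Ht i j Hi Hj. rewrite eta_eq by assumption.
    destruct i as [|[|[|i]]]; [| | |lia]; (destruct j as [|[|[|j]]]; [| | |lia]); reflexivity.
  - exists Nroot. split; [|split].
    + intros i tau Hi Ht. eexists. now apply Nroot_derive.
    + intros tau Ht. destruct (Nroot_distinct tau Ht) as (N01 & N02 & N12).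
      repeat split; auto; now apply Nroot_cubic.
    + intros t Ht H1 u. destruct (Nroot_distinct _ Ht) as (N01 & N02 & N12).
      (* Since [t_2] is nonzero, [N_i] is recovered from [u_i] as [2 (u_i - t_1) / t_2^2]. *)
      assert (Hu : forall i j, Nroot i (t 2%nat) <> Nroot j (t 2%nat) -> u i t <> u j t).
      { intros i j Hij E. apply Hij. unfold u in E.
        transitivity (RtoC 2 / Cpow (t 1%nat) 2 * (u i t - t 0%nat));
          [unfold u; simpl Cpow; field; assumption|].
        unfold u. rewrite E. simpl Cpow. field. assumption. }
      split; [|split; [|split; [|split]]]; auto.
      * intros x. rewrite det_gint by assumption. rewrite <- three_roots. unfold u.
        match goal with |- - ?l = RtoC 0 <-> _ => set (p := l) end.
        split; intros E; [transitivity (- - p); [ring|rewrite E; ring]|rewrite E; ring].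
      * now apply canonical_Nroot.
Qed.
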